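(* Let $n\ge2$ and $r\ge0$ be integers, and let $\Delta_{A,n}$ be an Alfeld split of an $n$-simplex in $\mathbb{R}^n$. Then the maximal order of supersmoothness of the Alfeld split is $$\operatorname{mos} S^r(\Delta_{A,n})=\rho_{n,r},\qquad \text{where } \rho_{n,r}:=r+(n-1)\left\lfloor\frac{r+1}{2}\right\rfloor.$$
   Context: Alfeld split: let $T$ be any $n$-dimensional simplex in $\mathbb{R}^n$ and $v$ an arbitrary point in the interior of $T$. The Alfeld split $\Delta_{A,n}$ is the set of the $n+1$ $n$-simplices obtained by connecting $v$ to each of the $n+1$ faces of $T$ of dimension $n-1$ (i.e. the convex hulls of $v$ and each such face). It is a cell around $v$. Let $\Delta_v$ be a cell around $v$ (a set of $n$-simplices of a simplicial mesh, all having $v$ as a vertex), here $\Delta_v=\Delta_{A,n}$. A spline on $\Delta_v$ is a family $\sigma=\{(U_T,f_T): T\in\Delta_v\}$ with, for each $T$, $U_T\subset\mathbb{R}^n$ open, $T\subset U_T$ and $f_T\in C^\infty(U_T)$ real-valued; $S(\Delta_v)$ is the set of all such splines. For a multi-index $\alpha$, $D^\alpha$ is the corresponding partial derivative, of order $|\alpha|$. For an integer $r\ge0$, $S^r(\Delta_v)$ is the set of $\sigma\in S(\Delta_v)$ such that $D^\alpha f_{T_1}|_F=D^\alpha f_{T_2}|_F$ for all $|\alpha|\le r$ and all $T_1,T_2\in\Delta_v$ such that $F=T_1\cap T_2$ is an $(n-1)$-face. For an integer $\rho\ge0$, $C^\rho(\Delta_v)$ is the set of $\sigma\in S(\Delta_v)$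 such that $D^\alpha f_{T_1}(v)=D^\alpha f_{T_2}(v)$ for all $|\alpha|\le\rho$ and all $T_1,T_2\in\Delta_v$. The maximal order of supersmoothness is $\operatorname{mos} S^r(\Delta_v)=\max\{\rho\ge r: S^r(\Delta_v)\subset C^\rho(\Delta_v)\}$ ($\rho$ an integer). *)

(* Defs.v *)
From mathcomp Require Import all_boot all_order all_algebra.
From mathcomp Require Import all_classical all_reals all_analysis.

Set Implicit Arguments.
Unset Strict Implicit.
Unset Printing Implicit Defensive.

Import Order.TTheory GRing.Theory Num.Theory.
Import numFieldNormedType.Exports.

Local Open Scope classical_set_scope.
Local Open Scope ring_scope.

Section Simplices.
Context {R : realType} {n : nat}.
Notation E := 'rV[R]_n.

Definition conv_hull (A : set E) : set E := smallest (@convex_set R E) A.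

Definition affine_independent k (p : 'I_k.+1 -> E) : Prop :=
  row_free (\matrix_(i < k) (p (lift ord0 i) - p ord0)).

Definition is_simplex k (T : set E) : Prop :=
  exists2 p : 'I_k.+1 -> E, affine_independent p & T = conv_hull (range p).

(* A face of dimension k is spanned by k + 1 of the vertices of the simplex T,
   whose dimension m is arbitrary. *)
Definition is_face k (F T : set E) : Prop :=
  exists m (p : 'I_m.+1 -> E) (A : {set 'I_m.+1}),
    [/\ affine_independent p, T = conv_hull (range p), #|A| = k.+1 &
        F = conv_hull (p @` [set` A])].

Definition alfeld_split (T : set E) (v : E) : set (set E) :=
  [set conv_hull (v |` F) | F in [set F | is_face n.-1 F T]].

End Simplices.

Section Derivatives.
Context {R : realType} {n : nat}.
Notation E := 'rV[R]_n.

Definition pderiv (i : 'I_n) (f : E -> R) : E -> R :=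
  fun x => 'D_(delta_mx ord0 i) f x.

(* pderivs [:: i; j; k] f is the iterated derivative d_i (d_j (d_k f)). *)
Definition pderivs (s : seq 'I_n) (f : E -> R) : E -> R := foldr pderiv f s.

(* f is of class C^oo on the open set U: all iterated partial derivatives, in
   any order, exist and are continuous on U.  The values of f outside U are
   irrelevant. *)
Definition smooth_on (U : set E) (f : E -> R) : Prop :=
  forall (s : seq 'I_n) (x : E), U x ->
    {for x, continuous (pderivs s f)} /\
    forall i, derivable (pderivs s f) x (delta_mx ord0 i).

Definition multi_order (a : 'I_n -> nat) : nat := (\sum_(i < n) a i)%N.

(* D^a = d_0^(a_0) d_1^(a_1) ... ; on smooth functions the order of the partial
   derivatives is immaterial. *)
Definition mderiv (a : 'I_n -> nat) (f : E -> R) : E -> R :=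
  pderivs (flatten [seq nseq (a i) i | i <- enum 'I_n]) f.

End Derivatives.

Section Splines.
Context {R : realType} {n : nat}.
Notation E := 'rV[R]_n.

Record piece := Piece { dom : set E ; fn : E -> R }.

Variable Delta : set (set E).

(* Families indexed by the members of Delta (Delta coerces to the type of its
   members). *)
Definition family := Delta -> piece.

Definition splines : set family :=
  [set s | forall T : Delta,
     [/\ open (dom (s T)), val T `<=` dom (s T) &
         smooth_on (dom (s T)) (fn (s T))]].

(* S^r(Delta). *)
Definition splinesS (r : nat) : set family :=
  [set s | splines s /\
     forall T1 T2 : Delta, let F := val T1 `&` val T2 in
       is_face n.-1 F (val T1) -> is_face n.-1 F (val T2) ->
     forall a : 'I_n -> nat, (multi_order a <= r)%N ->
     forall x, F x -> mderiv a (fn (s T1)) x = mderiv a (fn (s T2)) x].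

(* C^rho(Delta), relative to the point v. *)
Definition splinesC (v : E) (rho : nat) : set family :=
  [set s | splines s /\
     forall (T1 T2 : Delta) (a : 'I_n -> nat), (multi_order a <= rho)%N ->
       mderiv a (fn (s T1)) v = mderiv a (fn (s T2)) v].

(* m is the maximal order of supersmoothness mos S^r(Delta) of the cell Delta
   around v.  It is a relation, since the maximum might fail to exist. *)
Definition is_mos (v : E) (r m : nat) : Prop :=
  let A := [set rho : nat | (r <= rho)%N /\ splinesS r `<=` splinesC v rho] in
  A m /\ ubound A m.

End Splines.

Definition rho_alfeld (n r : nat) : nat := (r + n.-1 * (r.+1 %/ 2))%N.

(* Main.v *)
Require Import Defs.
From mathcomp Require Import all_boot all_order all_algebra.
From mathcomp Require Import all_classical all_reals all_analysis.
Import numFieldNormedType.Exports.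
From mathcomp Require Import ring lra zify.
Set Implicit Arguments.
Unset Strict Implicit.
Unset Printing Implicit Defensive.
Import Order.TTheory GRing.Theory Num.Theory.
Local Open Scope classical_set_scope.
Local Open Scope ring_scope.

(** Why the theorem holds.

    Let p_0, ..., p_n be the vertices of the simplex and v = sum_k lam_k p_k
    with lam_k > 0.  The rescaled rays q_k = lam_k (p_k - v) add up to 0, so a
    point is x = v + sum_k y_k q_k with y in R^(n+1) unique up to a common
    shift, the i-th simplex of the split is locally the region where y_i is the
    smallest coordinate, and the facet shared by the i-th and j-th simplices
    spans the hyperplane y_i = y_j.  The split is thus the braid arrangement.

    Fix a degree d.  The Taylor forms g_i of degree d at v of the pieces of a
    spline in S^r satisfy (y_i - y_j)^(r+1) | g_i - g_j: the derivatives of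
    order at most r of the difference of two pieces vanish on the shared facet,
    hence so do all their tangential derivatives at v.  Conversely every such
    family of forms is a spline.  The question becomes: what is the least degree
    of such a family whose members are not all equal?  (In the language of
    arrangements: of an element of Terao's module of derivations of the braid
    arrangement with constant multiplicity r+1.)

    Explicit families are the integrals g_i = int_(y_0)^(y_i) W(t) dt with
    W = prod_l (t - y_l)^(w_l) t^m: the substitution t = y_j + (y_i - y_j) u
    shows that g_i - g_j is divisible by (y_i - y_j)^(w_i + w_j + 1)
    [dvdp_prim_weight].

    Sharpness.  With k = floor((r+1)/2), weights k except one equal to r - k,
    and m = 0, all pair sums of weights are at least r and the degree is
    rho + 1.  The pieces have different Taylor forms of that degree, since
    otherwise Rolle's theorem would give W a root strictly between two
    consecutive nodes [sharp_contact, sharp_jets].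

    Supersmoothness.  There are n explicit families, linearly independent
    whenever the y_i are distinct, whose degrees add up to exactly
    (r+1) n (n+1) / 2 and are all larger than rho.  Replace one of them by a
    spline of degree d <= rho.  The n x n determinant of the differences with
    g_0 is still divisible by the product of all (y_i - y_j)^(r+1), as in
    Saito's criterion, but its degree is now too small: it is zero.  By Cramer's
    rule all coefficients of the spline on the explicit families are zero
    [row_swap_vanish, crossing_vanish].  Independence is again Rolle: a
    vanishing combination of rows is a polynomial with a root in each of the n
    gaps between the nodes.

    To need only univariate polynomials, this argument is run along the lines
    y_i = a_i + s a_i^2, which meet the hyperplanes y_i = y_j at the points
    s = - 1 / (a_i + a_j), distinct for a near (1, 2, 4, ..., 2^n).  This gives
    g_i = g_0 on an open set of points, and polarization turns it into equality
    of all partial derivatives of order d at v [polarization, supersmooth]. *)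

(** * Formal primitives and their divisibility *)

Section Primitive.
Context {B : comUnitRingType}.

(** Meant for rings in which the positive integers are units, such as a
    field of characteristic 0 and its polynomial ring. *)
Definition prim (p : {poly B}) : {poly B} :=
  \poly_(i < (size p).+1) (if i is j.+1 then p`_j / j.+1%:R else 0).

Lemma coef_prim p i : (prim p)`_i = if i is j.+1 then p`_j / j.+1%:R else 0.
Proof.
rewrite coef_poly; case: ifP => // /negbT; rewrite -leqNgt; case: i => // i.
by rewrite ltnS => /(nth_default 0) ->; rewrite mul0r.
Qed.

Lemma deriv_prim p : (forall i, (i.+1%:R : B) \is a GRing.unit) ->
  (prim p)^`() = p.
Proof.
move=> U; apply/polyP=> i.
by rewrite coef_deriv coef_prim -(mulr_natr (_ / _)) divrK.
Qed.

End Primitive.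

Lemma map_prim (B C : comUnitRingType) (f : {rmorphism B -> C}) (p : {poly B}) :
  (forall i, (i.+1%:R : B) \is a GRing.unit) ->
  map_poly f (prim p) = prim (map_poly f p).
Proof.
move=> U; apply/polyP=> -[|i]; rewrite coef_map !coef_prim /= ?rmorph0 //.
by rewrite coef_map /= rmorph_div ?rmorph_nat.
Qed.

Section Univariate.
Context {R : realType}.
Implicit Types (p q x y : {poly R}) (P Q A : {poly {poly R}}).

Lemma unit_nat_poly i : (i.+1%:R : {poly R}) \is a GRing.unit.
Proof. by rewrite -(rmorph_nat polyC) poly_unitE coefC size_polyC pnatr_eq0 unitfE pnatr_eq0. Qed.

Lemma unit_nat_real i : (i.+1%:R : R) \is a GRing.unit.
Proof. by rewrite unitfE pnatr_eq0. Qed.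

Lemma dvdp_bigsum (I : Type) (s : seq I) (a : pred I) (F : I -> {poly R}) h :
  (forall i, a i -> h %| F i) -> h %| \sum_(i <- s | a i) F i.
Proof. by move=> hF; elim/big_ind: _ => // p q; exact: dvdp_add. Qed.

(** [A.[1] - A.[0]] is the sum of the coefficients of [A] of positive degree,
    and each of them is a rational multiple of a coefficient of [A^`()]. *)
Lemma dvdp_horner_diff h A : (forall i, h %| A^`()`_i) -> h %| A.[1] - A.[0].
Proof.
move=> hA; rewrite horner_coef0 horner_coef.
case: (size A) (@nth_default _ 0 A) => [|s] sA.
  by rewrite big_ord0 sA // subr0 dvdp0.
rewrite big_ord_recl expr0 mulr1 addrAC subrr add0r.
apply: dvdp_bigsum => i _; rewrite expr1n mulr1 /=.
have := hA i; rewrite coef_deriv -[_ *+ _]scaler_nat.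
have -> : i.+1%:R *: A`_i.+1 = (i.+1%:R : R) *: A`_i.+1 by rewrite !scaler_nat.
by rewrite dvdpZr ?pnatr_eq0.
Qed.

(** The substitution t = x + (y - x) u brings the integral from [x] to [y] to
    the interval from 0 to 1 and extracts one factor y - x from dt and one from
    each factor t - x and t - y. *)
Lemma dvdp_prim_diff x y a b Q :
  (y - x) ^+ (a + b).+1 %|
    (prim (('X - x%:P) ^+ a * ('X - y%:P) ^+ b * Q)).[y] -
    (prim (('X - x%:P) ^+ a * ('X - y%:P) ^+ b * Q)).[x].
Proof.
set P := _ * Q; set z := y - x.
pose u : {poly {poly R}} := x%:P + z *: 'X.
pose A := prim P \Po u.
have -> : (prim P).[y] = A.[1].
  by rewrite horner_comp /u hornerD hornerC hornerZ hornerX mulr1 /z addrC subrK.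
have -> : (prim P).[x] = A.[0] by rewrite horner_comp /u hornerD hornerC hornerZ hornerX mulr0 addr0.
apply: dvdp_horner_diff => i.
rewrite deriv_comp (deriv_prim _ unit_nat_poly).
have -> : u^`() = z%:P by rewrite /u derivD derivC derivZ derivX add0r alg_polyC.
have -> : P \Po u = z ^+ (a + b) *: ('X ^+ a * ('X - 1) ^+ b * (Q \Po u)).
  rewrite /P !comp_polyM !rmorphXn /= !comp_polyB !comp_polyX !comp_polyC.
  have -> : u - x%:P = z *: 'X by rewrite /u addrAC subrr add0r.
  have -> : u - y%:P = z *: ('X - 1).
    by rewrite /u scalerBr alg_polyC /z polyCB; ring.
  rewrite !exprZn exprD -!mul_polyC (rmorphM polyC) /=; ring.
by rewrite mulrC mul_polyC scalerA coefZ -exprS dvdp_mulIl.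
Qed.

(** Bound on the total degree of [P], the coefficients of [P] being themselves
    polynomials in the parameter of a line.  The truncated subtraction makes it
    bound the degree of [P] too. *)
Definition tdeg d P := forall k, (size (P`_k)%R <= d.+1 - k)%N.

Lemma tdegM d e P Q : tdeg d P -> tdeg e Q -> tdeg (d + e) (P * Q).
Proof.
move=> hP hQ k; rewrite coefM; apply: (leq_trans (size_sum _ _ _)).
apply/bigmax_leqP => i _.
have [->|nzP] := eqVneq P`_i 0; first by rewrite mul0r size_poly0.
have [->|nzQ] := eqVneq Q`_(k - i) 0; first by rewrite mulr0 size_poly0.
apply: (leq_trans (size_polyMleq _ _)).
have := hP i; have := hQ (k - i)%N; move: nzP nzQ; rewrite -!size_poly_gt0.
have := ltn_ord i; lia.
Qed.

Lemma tdeg1 : tdeg 0 1.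
Proof. by move=> [|k]; rewrite coef1 /= ?size_poly1 ?size_poly0. Qed.

Lemma tdegX d P n : tdeg d P -> tdeg (n * d) (P ^+ n).
Proof.
move=> hP; elim: n => [|n IH]; first by rewrite mul0n; exact: tdeg1.
by rewrite exprS mulSn; apply: tdegM.
Qed.

Lemma tdeg_prod (I : Type) (s : seq I) (p : pred I) (d : I -> nat) F :
  (forall i, p i -> tdeg (d i) (F i)) ->
  tdeg (\sum_(i <- s | p i) d i) (\prod_(i <- s | p i) F i).
Proof.
move=> h; elim/big_ind2: _ => //; first exact: tdeg1.
by move=> *; exact: tdegM.
Qed.

Lemma tdeg_XsubC x : (size x <= 2)%N -> tdeg 1 ('X - x%:P).
Proof.
move=> hx [|[|k]]; rewrite coefB coefX coefC /=.
- by rewrite sub0r size_polyN.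
- by rewrite subr0 size_poly1.
- by rewrite subr0 size_poly0.
Qed.

Lemma tdeg_polyX : tdeg 1 'X.
Proof. by have := @tdeg_XsubC 0; rewrite subr0; apply; rewrite size_poly0. Qed.

Lemma tdeg_prim d P : tdeg d P -> tdeg d.+1 (prim P).
Proof.
move=> hP [|k]; rewrite coef_prim ?size_poly0 // subSS.
rewrite -(rmorph_nat polyC) -[_^-1]/(_^-1)%R.
have -> : ((k.+1%:R)%:P : {poly R})^-1 = ((k.+1%:R)^-1)%:P by rewrite polyCV.
by rewrite mulrC mul_polyC size_scale // invr_eq0 pnatr_eq0.
Qed.

Lemma tdeg_horner d P x : (size x <= 2)%N -> tdeg d P -> (size P.[x] <= d.+1)%N.
Proof.
move=> hx hP; rewrite horner_coef; apply: (leq_trans (size_sum _ _ _)).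
apply/bigmax_leqP => i _.
have [->|nzP] := eqVneq P`_i 0; first by rewrite mul0r size_poly0.
apply: (leq_trans (size_polyMleq _ _)).
have := hP i; move: nzP; rewrite -size_poly_gt0.
have := size_poly_exp_leq x i.
have : ((size x).-1 * i <= i)%N by move: hx; case: (size x) => [|[|[|]]] //=; nia.
move: (nat_of_ord i) => e; move: ((size x).-1 * e)%N (size (x ^+ e)) (size (P`_e)%R) => a b c; lia.
Qed.

Lemma horner_prim_eval P x (s : R) :
  (prim P).[x].[s] = (prim (map_poly (horner_eval s) P)).[x.[s]].
Proof.
rewrite -(map_prim _ _ unit_nat_poly).
by rewrite -[x.[s]]/(horner_eval s x) horner_map.
Qed.

Lemma dvdp_prod_coprime (I : eqType) (s : seq I) (F : I -> {poly R}) p :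
  uniq s -> {in s &, forall i j, i != j -> coprimep (F i) (F j)} ->
  (forall i, i \in s -> F i %| p) -> \prod_(i <- s) F i %| p.
Proof.
elim: s => [|i s IH] /=; first by rewrite big_nil dvd1p.
move=> /andP[si us] co dv; rewrite big_cons Gauss_dvdp.
  rewrite dv ?mem_head //= IH // => [j k js ks|j js].
    by apply: co; rewrite inE ?js ?ks orbT.
  by apply: dv; rewrite inE js orbT.
rewrite big_seq; elim/big_rec: _ => [|j q js cq]; first exact: coprimep1.
rewrite coprimepMr cq andbT; apply: co; rewrite ?inE ?eqxx ?js ?orbT //.
by apply: contraNneq si => ->.
Qed.

(** If M u = 0 modulo h and an entry of u is 1 then M is singular modulo h; the
    adjugate makes this work over any h. *)
Lemma dvdp_det n (M : 'M[{poly R}]_n) h (u : 'cV[{poly R}]_n) k :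
  u k ord0 = 1 -> (forall e, h %| (M *m u) e ord0) -> h %| \det M.
Proof.
move=> uk hM.
have -> : \det M = (\adj M *m (M *m u)) k ord0.
  by rewrite mulmxA mul_adj_mx mul_scalar_mx mxE uk mulr1.
rewrite mxE; apply: dvdp_bigsum => j _; exact: dvdp_mull.
Qed.

Lemma size_det_rows n (M : 'M[{poly R}]_n) (D : 'I_n -> nat) :
  (forall e i, (size (M e i) <= (D e).+1)%N) ->
  (size (\det M) <= (\sum_e D e).+1)%N.
Proof.
move=> hM; rewrite /determinant; apply: (leq_trans (size_sum _ _ _)).
apply/bigmax_leqP => s _; rewrite size_Msign.
elim/big_ind2: _ => [|d1 p d2 q h1 h2|i _]; rewrite ?size_poly1 ?hM //.
by rewrite (leq_trans (size_polyMleq _ _)) //; lia.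
Qed.
End Univariate.

(** * Determinants of crossing families *)

Section Core.
Context {R : realType}.

Lemma card_ltn_pairs N :
  (\sum_(p : 'I_N * 'I_N | (p.1 < p.2)%N) 1 = 'C(N, 2))%N.
Proof.
rewrite -(pair_big_dep predT (fun i j : 'I_N => (i < j)%N) (fun _ _ => 1%N)) /=.
rewrite (exchange_big_dep predT) //= -triangular_sum big_mkord.
by apply: eq_bigr => j _; rewrite (big_ord_narrow (ltnW (ltn_ord j))) sum_nat_const card_ord muln1.
Qed.

(** Saito's argument on a line.  Where [x i] and [x j] meet, two columns agree
    (or, for [j = 0], one column vanishes) to order [m], so the determinant does;
    the crossings are at distinct parameters, and together they exceed the degree
    that the rows allow. *)
Lemma det_eq0_crossings n m (x : 'I_n.+1 -> {poly R})
    (G : 'I_n -> 'I_n.+1 -> {poly R}) (D : 'I_n -> nat) :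
  (forall i j : 'I_n.+1, (i < j)%N -> size (x i - x j) = 2) ->
  (forall p q : 'I_n.+1 * 'I_n.+1, (p.1 < p.2)%N -> (q.1 < q.2)%N -> p != q ->
     coprimep (x p.1 - x p.2) (x q.1 - x q.2)) ->
  (forall e (i j : 'I_n.+1), (i < j)%N -> (x i - x j) ^+ m %| G e i - G e j) ->
  (forall e i, (size (G e i - G e ord0)%R <= (D e).+1)%N) ->
  (\sum_e D e < m * 'C(n.+1, 2))%N ->
  \det (\matrix_(e, i < n) (G e (lift ord0 i) - G e ord0)) = 0.
Proof.
move=> sz co dv szG; apply: contraTeq => nz; rewrite -leqNgt.
set M := \matrix_(e, i) _ in nz *.
pose F (p : 'I_n.+1 * 'I_n.+1) := (x p.1 - x p.2) ^+ m.
pose s := [seq p : 'I_n.+1 * 'I_n.+1 <- index_enum ('I_n.+1 * 'I_n.+1)%type | (p.1 < p.2)%N].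
have ms p : p \in s -> (p.1 < p.2)%N by rewrite mem_filter => /andP[].
have dvM : \prod_(p <- s) F p %| \det M.
  apply: dvdp_prod_coprime; first by rewrite filter_uniq // index_enum_uniq.
    move=> p q ps qs pq; apply: coprimep_expl; apply: coprimep_expr.
    by apply: co; rewrite ?ms.
  move=> [i j] /ms /= lij.
  have j0 : (0 < j)%N by apply: leq_ltn_trans lij.
  have [k jE] : exists k, j = lift ord0 k.
    by case: (unliftP ord0 j) j0 => [k ->|->] // _; exists k.
  (* The column of j minus the column of i; the column of index 0 is absent, and stands for 0. *)
  apply: (@dvdp_det _ _ M _
    (\col_k ((lift ord0 k == j)%:R - (lift ord0 k == i)%:R)) k).
    rewrite mxE -jE eqxx; case: eqP lij => [->|_]; rewrite ?ltnn // subr0 //.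
  move=> e; rewrite mxE.
  have -> : \sum_j0 M e j0 * (\col_k ((lift ord0 k == j)%:R
               - (lift ord0 k == i)%:R) : 'cV[{poly R}]_n) j0 ord0
     = - (G e i - G e j).
    have key (l : 'I_n.+1) :
       \sum_(j0 < n) M e j0 * (lift ord0 j0 == l)%:R = G e l - G e ord0.
      case: (unliftP ord0 l) => [l' ->|->].
        rewrite (bigD1 l') //= eqxx mulr1 mxE big1 ?addr0 // => j1 nj1.
        by rewrite (inj_eq (@lift_inj _ _)) (negbTE nj1) mulr0.
      by rewrite subrr big1 // => j1 _; rewrite (eq_sym (lift _ _)) (negbTE (neq_lift _ _)) mulr0.
    under eq_bigr => l _ do rewrite [X in _ * X]mxE mulrBr.
    rewrite sumrB !key; ring.
  by rewrite dvdpNr dv.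
have h1 := dvdp_leq nz dvM.
have h2 : (size (\det M) <= (\sum_e D e).+1)%N.
  by apply: size_det_rows => e i; rewrite mxE.
have -> : (m * 'C(n.+1, 2) = (size (\prod_(p <- s) F p)%R).-1)%N.
  have lead p : p \in s -> lead_coef (F p) != 0 /\ size (F p) = m.+1.
    move=> /ms lp; have sp := sz _ _ lp.
    have nz0 : x p.1 - x p.2 != 0 by rewrite -size_poly_gt0 sp.
    rewrite lead_coef_eq0 expf_neq0 //; split => //.
    by rewrite -[LHS]prednK ?size_poly_gt0 ?expf_neq0 // size_exp sp mul1n.
  have : \prod_(p <- s) F p != 0 /\
     (size (\prod_(p <- s) F p)) = (\sum_(p <- s) m).+1.
    have : {subset s <= s} by [].
    elim: {-2}s => [_|p s' IH hs]; first by rewrite !big_nil oner_eq0 size_poly1.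
    have [nz1 sz1] := IH (fun q qs => hs q (mem_behead (s := p :: s') qs)).
    have [] := lead p (hs p (mem_head _ _)); rewrite lead_coef_eq0 => nz2 sz2.
    rewrite !big_cons mulf_neq0 // size_mul // sz1 sz2; split => //=.
    by rewrite addnS.
  case=> _ ->; rewrite /= -card_ltn_pairs big_distrr /= /s big_filter.
  by apply: eq_bigr => *; rewrite muln1.
by have := leq_trans h1 h2; case: (size (\prod_(p <- s) F p)%R).
Qed.

End Core.

(** * Integrals of weights and the row exchange *)

Lemma big_split2 (S : comNzRingType) N (F : 'I_N -> S) (z : S) (i j : 'I_N) : i != j ->
  \prod_l F l * z = F j * F i * (\prod_(l | (l != i) && (l != j)) F l * z).
Proof.
by move=> ij; rewrite (bigD1 i) //= (bigD1 j) 1?eq_sym //= !mulrA [F j * _]mulrC.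
Qed.

Section Basis.
Context {R : realType} (n : nat).
Implicit Types (w : 'I_n.+1 -> nat) (t : nat).

(** The integrands of the explicit families of forms, with nodes [x l]. *)
Definition weight_poly (B : comUnitRingType) w t (x : 'I_n.+1 -> B) : {poly B} :=
  \prod_l ('X - (x l)%:P) ^+ w l * 'X ^+ t.

Lemma tdeg_weight w t (x : 'I_n.+1 -> {poly R}) :
  (forall l, (size (x l) <= 2)%N) -> tdeg (\sum_l w l + t) (weight_poly w t x).
Proof.
move=> hx; apply: tdegM.
  by apply: tdeg_prod => l _; have := tdegX (w l) (tdeg_XsubC (hx l)); rewrite muln1.
by have := tdegX t (@tdeg_polyX R); rewrite muln1.
Qed.

Lemma dvdp_prim_weight r w t (x : 'I_n.+1 -> {poly R}) (i j : 'I_n.+1) :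
  i != j -> (r <= w i + w j)%N ->
  (x i - x j) ^+ r.+1 %|
    (prim (weight_poly w t x)).[x i] - (prim (weight_poly w t x)).[x j].
Proof.
move=> ij rw; have -> : weight_poly w t x = ('X - (x j)%:P) ^+ w j * ('X - (x i)%:P) ^+ w i *
    (\prod_(l | (l != i) && (l != j)) ('X - (x l)%:P) ^+ w l * 'X ^+ t).
  exact: big_split2.
apply: (@dvdp_trans _ ((x i - x j) ^+ (w j + w i).+1)).
  by rewrite dvdp_exp2l // ltnS addnC.
exact: dvdp_prim_diff.
Qed.

Lemma map_weight_poly (B C : comUnitRingType) (f : {rmorphism B -> C}) w t x :
  map_poly f (weight_poly w t x) = weight_poly w t (fun l => f (x l)).
Proof.
rewrite /weight_poly rmorphM rmorph_prod rmorphXn /= map_polyX; congr (_ * _).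
by apply: eq_bigr => l _; rewrite rmorphXn rmorphB /= map_polyX map_polyC.
Qed.

Lemma rolle_poly (p : {poly R}) (a b : R) :
  a < b -> p.[a] = p.[b] -> exists2 c, a < c < b & p^`().[c] = 0.
Proof.
move=> ab pab; have [|||c] := @Rolle R (horner p) a b ab.
- by move=> c _; exact: derivable_horner.
- by apply: continuous_subspaceT; exact: continuous_horner.
- exact: pab.
move=> cab hc; exists c; first by rewrite in_itv /= in cab.
by rewrite derivE derive1E (@derive_val _ _ _ _ _ _ _ hc).
Qed.

Variable a : 'I_n.+1 -> R.
Hypothesis a_incr : forall i j : 'I_n.+1, (i < j)%N -> a i < a j.

(** If the integral of weight times [q] over each gap between nodes is zero, then
    the integrand has a root inside each gap by Rolle's theorem; the weight has
    its roots at the nodes only, so [q] has them. *)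
Lemma interlaced_roots k (q A : {poly R}) :
  A^`() = \prod_l ('X - (a l)%:P) ^+ k * q ->
  (forall i, A.[a i] = A.[a ord0]) ->
  exists xi : 'I_n -> R, forall e : 'I_n,
    [/\ a (widen_ord (leqnSn n) e) < xi e, xi e < a (lift ord0 e) & root q (xi e)].
Proof.
move=> dA Aa.
have H (e : 'I_n) : exists c, [/\ a (widen_ord (leqnSn n) e) < c, c < a (lift ord0 e) & root q c].
  have lt : a (widen_ord (leqnSn n) e) < a (lift ord0 e) by apply: a_incr; rewrite /= /bump.
  have [|c /andP[c1 c2]] := @rolle_poly A _ _ lt; first by rewrite !Aa.
  rewrite dA hornerM => /eqP; rewrite mulf_eq0 => /orP[|rq]; last first.
    by exists c; split=> //; rewrite /root.
  rewrite horner_prod => /prodf_eq0[l _].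
  rewrite horner_exp expf_eq0 hornerXsubC subr_eq0 => /andP[_ /eqP cE].
  exfalso; move: c1 c2; rewrite cE => c1 c2.
  have [le|lt'] := leqP l e.
    have [/eqP el|ne] := boolP (l == e :> nat).
      by have lE : l = widen_ord (leqnSn n) e; [exact: val_inj|move: c1; rewrite lE ltxx].
    have : a l < a (widen_ord (leqnSn n) e) by apply: a_incr; rewrite /= ltn_neqAle ne.
    by move=> /(lt_trans c1); rewrite ltxx.
  have [/eqP el|ne] := boolP (l == e.+1 :> nat).
    by have lE : l = lift ord0 e; [apply: val_inj; rewrite /= /bump|move: c2; rewrite lE ltxx].
  have : a (lift ord0 e) < a l by apply: a_incr; rewrite /= /bump ltn_neqAle eq_sym ne.
  by move=> /(lt_trans c2); rewrite ltxx.
exists (fun e => projT1 (cid (H e))) => e; exact: (projT2 (cid (H e))).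
Qed.

Lemma interlaced_inj (xi : 'I_n -> R) :
  (forall e : 'I_n, a (widen_ord (leqnSn n) e) < xi e /\ xi e < a (lift ord0 e)) ->
  injective xi.
Proof.
move=> hx.
have mono (e f : 'I_n) : (e < f)%N -> xi e < xi f.
  move=> ef; apply: lt_trans (hx f).1; apply: lt_le_trans (hx e).2 _.
  have [/eqP E|ne] := boolP (e.+1 == f :> nat).
    by have -> : lift ord0 e = widen_ord (leqnSn n) f by apply: val_inj; rewrite /= /bump.
  by apply/ltW/a_incr; rewrite /= /bump ltn_neqAle ne.
move=> e f E; apply: val_inj; case: (ltngtP e f) => // /mono; rewrite E ltxx //.
Qed.

Lemma poly_eq0_roots (s : seq R) (q : {poly R}) :
  (size q <= size s)%N -> uniq s -> all (root q) s -> q = 0.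
Proof.
move=> sq us rs; apply/eqP; apply: contraT => nz.
by have := max_poly_roots nz rs us; rewrite ltnNge sq.
Qed.

(** The exchange argument.  Replace row [e0] of the matrix [M] of the explicit
    families by [gam].  The total degree drops to less than the number of
    crossings, so the determinant vanishes for every [e0]; these determinants are
    the entries of [g *m \adj M].  At parameter 0 the matrix is invertible, since
    a dependency between its rows would give a [q] with interlaced roots, which
    is what the independence hypothesis excludes.  Hence [g] vanishes at 0. *)
Lemma row_swap_vanish r d (w : 'I_n -> 'I_n.+1 -> nat) (t : 'I_n -> nat)
    (x gam : 'I_n.+1 -> {poly R}) k (Q0 : 'I_n -> {poly R}) :
  (forall l, (size (x l) <= 2)%N) -> (forall l, (x l).[0] = a l) ->
  (forall i j : 'I_n.+1, (i < j)%N -> size (x i - x j) = 2) ->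
  (forall p q : 'I_n.+1 * 'I_n.+1, (p.1 < p.2)%N -> (q.1 < q.2)%N -> p != q ->
     coprimep (x p.1 - x p.2) (x q.1 - x q.2)) ->
  (forall e (i j : 'I_n.+1), i != j -> (r <= w e i + w e j)%N) ->
  (forall e, weight_poly (w e) (t e) a = \prod_l ('X - (a l)%:P) ^+ k * Q0 e) ->
  (forall (c : 'I_n -> R) (xi : 'I_n -> R),
     (forall e : 'I_n, a (widen_ord (leqnSn n) e) < xi e /\ xi e < a (lift ord0 e)) ->
     (forall e, root (\sum_f c f *: Q0 f) (xi e)) -> forall e, c e = 0) ->
  (forall i, (size (gam i) <= d.+1)%N) ->
  (forall i j : 'I_n.+1, (i < j)%N -> (x i - x j) ^+ r.+1 %| gam i - gam j) ->
  (forall e, (d <= \sum_l w e l + t e)%N) ->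
  (\sum_e (\sum_l w e l + t e).+1 <= r.+1 * 'C(n.+1, 2))%N ->
  forall i, (gam i).[0] = (gam ord0).[0].
Proof.
move=> sx x0 sxx co rw wa indep sg dg dw tot.
pose Th e i := (prim (weight_poly (w e) (t e) x)).[x i].
pose M := \matrix_(e, i < n) (Th e (lift ord0 i) - Th e ord0).
pose g := \row_(i < n) (gam (lift ord0 i) - gam ord0).
have adj0 : g *m \adj M = 0.
  apply/rowP => e0; rewrite mxE [RHS]mxE.
  pose G e := if e == e0 then gam else Th e.
  pose D e := if e == e0 then d else (\sum_l w e l + t e).+1.
  transitivity (\det (\matrix_(e, i < n) (G e (lift ord0 i) - G e ord0))).
    rewrite (expand_det_row _ e0); apply: eq_bigr => i _.
    rewrite !mxE /G eqxx; congr (_ * _).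
    rewrite /cofactor; congr (_ * \det _); apply/matrixP => p q.
    by rewrite !mxE eq_sym (negbTE (neq_lift _ _)).
  apply: (det_eq0_crossings (m := r.+1) (x := x) (D := D)) => //.
  - move=> e i j ij; rewrite /G; case: ifP => _; first exact: dg.
    by apply: dvdp_prim_weight; rewrite ?rw // neq_ltn ij.
  - move=> e i; rewrite /G /D.
    case: ifP => _; apply: (leq_trans (size_polyD _ _)); rewrite size_polyN geq_max.
      by rewrite !sg.
    by rewrite !tdeg_horner //; apply/tdeg_prim/tdeg_weight.
  - apply: leq_trans tot; rewrite (bigD1 e0) //= [X in (_ <= X)%N](bigD1 e0) //=.
    rewrite /D eqxx -addSn leq_add // ?ltnS ?dw //.
    by apply: eq_leq; apply: eq_bigr => e /negbTE ->.
have : map_mx (horner_eval 0) (g *m \adj M) = 0 by rewrite adj0 map_mx0.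
rewrite map_mxM map_mx_adj.
set M0 := map_mx _ M; set g0 := map_mx _ g => /(congr1 (mulmx^~ M0)).
(* Multiplying by M0 on the right turns the adjugate into the determinant. *)
rewrite -mulmxA mul_adj_mx mul0mx mul_mx_scalar => /eqP; rewrite scaler_eq0.
have -> /= : (\det M0 == 0) = false.
  apply/negP => /det0P[c nzc cM].
  pose A e := prim (weight_poly (w e) (t e) a).
  have M0E e i : M0 e i = (A e).[a (lift ord0 i)] - (A e).[a ord0].
    have ev : (fun l => horner_eval 0 (x l)) = a by apply/funext => l; exact: x0.
    transitivity ((M e i).[0]); first by rewrite mxE.
    by rewrite mxE hornerD hornerN /Th !horner_prim_eval !map_weight_poly !x0 ev.
  have [||xi hxi] := @interlaced_roots k (\sum_e c ord0 e *: Q0 e) (\sum_e c ord0 e *: A e).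
  - rewrite linear_sum mulr_sumr; apply: eq_bigr => e _.
    by rewrite /= derivZ (deriv_prim _ unit_nat_real) wa scalerAr.
  - move=> i; case: (unliftP ord0 i) => [j|] -> //.
    move/rowP/(_ j): cM; rewrite !mxE => /eqP.
    under eq_bigr do rewrite M0E mulrBr.
    rewrite sumrB subr_eq0 !horner_sum => /eqP cM.
    by under eq_bigr do rewrite hornerZ; under [RHS]eq_bigr do rewrite hornerZ.
  case/eqP: nzc; apply/rowP => e; rewrite [RHS]mxE.
  by apply: (indep (c ord0) xi) => f; case: (hxi f).
move=> /eqP g00 i; case: (unliftP ord0 i) => [j|] -> //.
move/rowP/(_ j): g00; rewrite [RHS]mxE.
have -> : g0 ord0 j = (g ord0 j).[0] by rewrite mxE.
rewrite mxE hornerD hornerN => /eqP.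
by rewrite subr_eq0 => /eqP.
Qed.

End Basis.

(** * Vanishing below the critical degree *)

Section Parabola.
Context {R : realType} (n : nat).
Variable a : 'I_n.+1 -> R.
Hypothesis a_incr : forall i j : 'I_n.+1, (i < j)%N -> a i < a j.
Hypothesis a_sum0 : forall i j : 'I_n.+1, (i < j)%N -> a i + a j != 0.
Hypothesis a_sum : forall p q : 'I_n.+1 * 'I_n.+1, (p.1 < p.2)%N -> (q.1 < q.2)%N ->
  p != q -> a p.1 + a p.2 != a q.1 + a q.2.

(** The i-th coordinate of the line with origin [a] and direction the squares of
    the entries of [a].  This direction is chosen because the coordinates i and j
    then meet at the parameter - 1 / (a i + a j), so that the crossings are
    distinct as soon as the sums of two entries of [a] are. *)
Definition parabola i : {poly R} := (a i)%:P + (a i ^+ 2) *: 'X.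

Lemma parabolaB i j :
  parabola i - parabola j = (a i - a j) *: (1 + (a i + a j) *: 'X).
Proof. by rewrite /parabola -!mul_polyC !(rmorphXn, rmorphB, rmorphD) /=; ring. Qed.

Lemma linear_factor (s : R) : s != 0 -> 1 + s *: 'X = s *: ('X - (- s^-1)%:P).
Proof.
by move=> s0; rewrite -!mul_polyC polyCN opprK mulrDr -polyCM divff // addrC.
Qed.

Lemma size_parabolaB (i j : 'I_n.+1) : (i < j)%N -> size (parabola i - parabola j) = 2.
Proof.
move=> ij; rewrite parabolaB size_scale; last by rewrite subr_eq0 lt_eqF ?a_incr.
by rewrite linear_factor ?a_sum0 // size_scale ?a_sum0 // size_XsubC.
Qed.

Lemma coprimep_parabolaB (p q : 'I_n.+1 * 'I_n.+1) :
  (p.1 < p.2)%N -> (q.1 < q.2)%N -> p != q ->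
  coprimep (parabola p.1 - parabola p.2) (parabola q.1 - parabola q.2).
Proof.
move=> hp hq pq; rewrite !parabolaB.
rewrite coprimepZl ?subr_eq0 ?lt_eqF ?a_incr //.
rewrite coprimepZr ?subr_eq0 ?lt_eqF ?a_incr //.
rewrite (linear_factor (a_sum0 hq)) coprimepZr ?a_sum0 // coprimep_XsubC.
rewrite /root !hornerE; apply: contra (a_sum hp hq pq) => /eqP e.
move/eqP: e; rewrite mulrN subr_eq0 => /eqP e.
by rewrite -[X in X == _](divfK (a_sum0 hq)) -e mul1r.
Qed.

Lemma size_parabola i : (size (parabola i) <= 2)%N.
Proof.
rewrite (leq_trans (size_polyD _ _)) // geq_max (leq_trans (size_polyC_leq1 _)) //.
by rewrite (leq_trans (size_scale_leq _ _)) // size_polyX.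
Qed.

Lemma parabola0 i : (parabola i).[0] = a i.
Proof. by rewrite /parabola !hornerE. Qed.

Lemma interlaced_uniq (xi : 'I_n -> R) :
  (forall e : 'I_n, a (widen_ord (leqnSn n) e) < xi e /\ xi e < a (lift ord0 e)) ->
  uniq [seq xi e | e <- enum 'I_n].
Proof. by move=> h; rewrite map_inj_uniq ?enum_uniq //; exact: interlaced_inj h. Qed.

(** The families to which the exchange applies.  For r = 2k: all weights k and
    an additional factor t^e, e < n, of degrees (n+1) k + e + 1.  For r = 2k + 1:
    weights k + 1 except at the node [lift ord0 e], where the weight is k; all
    degrees are (n+1)(k+1).  In both cases the degrees add up to
    (r+1) n (n+1) / 2, and the smallest is one more than [rho_alfeld n r]. *)
Lemma crossing_vanish r d (gam : 'I_n.+1 -> {poly R}) : (0 < n)%N ->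
  (d <= rho_alfeld n r)%N ->
  (forall i, (size (gam i) <= d.+1)%N) ->
  (forall i j : 'I_n.+1, (i < j)%N ->
     (parabola i - parabola j) ^+ r.+1 %| gam i - gam j) ->
  forall i, (gam i).[0] = (gam ord0).[0].
Proof.
move=> n0 dr sg dg; rewrite /rho_alfeld in dr.
have bin : ('C(n.+1, 2) * 2 = n.+1 * n)%N by rewrite bin2 muln2 halfK oddM /= andNb subn0.
have [k [rk|rk]] : exists k, r = k.*2 \/ r = k.*2.+1.
  exists r./2; rewrite -{1 3}(odd_double_half r); case: (odd r); [by right|by left].
- apply: (@row_swap_vanish R n a a_incr r d (fun _ _ => k) (fun e => e) parabola gam k
    (fun e => 'X ^+ e)) => //.
  + exact: size_parabola.
  + exact: parabola0.
  + exact: size_parabolaB.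
  + exact: coprimep_parabolaB.
  + by move=> _ i j _; rewrite rk addnn.
  + move=> c xi hxi rx.
    have q0 : \poly_(f < n) (if insub f is Some f' then c f' else 0) = 0 :> {poly R}.
      apply: (@poly_eq0_roots R [seq xi e | e <- enum 'I_n]).
      * by rewrite size_map -cardE card_ord size_poly.
      * exact: interlaced_uniq.
      * apply/allP => y /mapP[e _ ->]; rewrite poly_def.
        have := rx e; congr (is_true (root _ _)); apply: eq_bigr => f _.
        by rewrite valK.
    by move=> e; move/(congr1 (fun p : {poly R} => p`_e)): q0; rewrite coef_poly coef0 ltn_ord valK.
  + move=> e; rewrite sum_nat_const card_ord; move: dr; rewrite rk; nia.
  + have -> : (\sum_(e < n) (\sum_(l < n.+1) k + e).+1 = n * (n.+1 * k) + 'C(n.+1, 2))%N.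
      rewrite -triangular_sum big_mkord [in RHS]big_ord_recl /= add0n.
      rewrite -[X in (X * _)%N](card_ord n) -sum_nat_const -big_split /=.
      by apply: eq_bigr => e _; rewrite sum_nat_const card_ord addnS.
    by rewrite rk; move: bin; move: ('C(_, _)) => b; nia.
- have sumw (e : 'I_n) : (\sum_(l < n.+1) (k + (l != lift ord0 e)) = n.+1 * k + n)%N.
    rewrite big_split /= sum_nat_const card_ord; congr addn.
    rewrite (bigD1 (lift ord0 e)) //= eqxx add0n.
    transitivity #|predC1 (lift ord0 e)|; last by rewrite cardC1 card_ord.
    by rewrite -sum1_card; apply: eq_bigr => l ->.
  apply: (@row_swap_vanish R n a a_incr r d (fun e l => (k + (l != lift ord0 e))%N)
    (fun=> 0%N) parabola gam k
    (fun e => \prod_(l | l != lift ord0 e) ('X - (a l)%:P))) => //.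
  + exact: size_parabola.
  + exact: parabola0.
  + exact: size_parabolaB.
  + exact: coprimep_parabolaB.
  + move=> e i j ij; rewrite rk -addnn.
    have : (1 <= (i != lift ord0 e) + (j != lift ord0 e))%N.
      by case: (eqVneq i (lift ord0 e)) ij => //= ->; rewrite eq_sym => ->.
    lia.
  + move=> e; rewrite /weight_poly expr0 mulr1.
    under eq_bigr do rewrite exprD.
    rewrite big_split /=; congr (_ * _); rewrite [RHS]big_mkcond /=.
    by apply: eq_bigr => l _; case: ifP; rewrite ?expr1 ?expr0.
  + move=> c xi hxi rx.
    (* The node of index 0 is a root of every Q_f, and completes the n interlaced roots to n + 1. *)
    have q0 : \sum_f c f *: \prod_(l | l != lift ord0 f) ('X - (a l)%:P) = 0.
      apply: (@poly_eq0_roots R (a ord0 :: [seq xi e | e <- enum 'I_n])).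
      * rewrite /= size_map -cardE card_ord.
        rewrite (leq_trans (size_sum _ _ _)) //; apply/bigmax_leqP => f _.
        rewrite (leq_trans (size_scale_leq _ _)) // (leq_trans (size_poly_prod_leq _ _)) //.
        under eq_bigr do rewrite size_XsubC.
        by rewrite sum_nat_const cardC1 card_ord /=; lia.
      * rewrite /= interlaced_uniq // andbT; apply/negP => /mapP[e _ e0].
        have := (hxi e).1; rewrite -e0.
        case: (posnP e) => [ez|ep].
          have -> : widen_ord (leqnSn n) e = ord0 by apply: val_inj.
          by rewrite ltxx.
        have := @a_incr ord0 (widen_ord (leqnSn n) e) ep => h1 h2.
        by have := lt_trans h1 h2; rewrite ltxx.
      * rewrite /=; apply/andP; split; last by apply/allP => y /mapP[e _ ->].
        rewrite /root horner_sum big1 // => f _; rewrite hornerZ horner_prod.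
        by rewrite (bigD1 ord0) ?neq_lift //= hornerXsubC subrr mul0r mulr0.
    move=> e; move/(congr1 (fun p : {poly R} => p.[a (lift ord0 e)])): q0.
    rewrite horner0 horner_sum (bigD1 e) //= [X in _ + X]big1 ?addr0 => [|f fe].
      rewrite hornerZ horner_prod => /eqP; rewrite mulf_eq0 => /orP[/eqP //|].
      case/prodf_eq0 => l nl; rewrite hornerXsubC subr_eq0 => /eqP al.
      by case: (ltngtP l (lift ord0 e)) nl => [/a_incr|/a_incr|/val_inj ->]; rewrite ?al ?ltxx ?eqxx.
    rewrite hornerZ horner_prod (bigD1 (lift ord0 e)) /= ?hornerXsubC ?subrr ?mul0r ?mulr0 //.
    by rewrite (inj_eq (@lift_inj _ _)) eq_sym.
  + move=> e; rewrite addn0 sumw; move: dr; rewrite rk divn2 -doubleS doubleK; nia.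
  + under eq_bigr do rewrite addn0 sumw.
    rewrite sum_nat_const card_ord rk; move: bin; move: ('C(_, _)) => b; nia.
Qed.
End Parabola.

(** * Jets, their restriction to lines, and polarization *)

Lemma poly_eq0_near0 (R : realType) (p : {poly R}) (e : R) : 0 < e ->
  (forall s, `|s| < e -> p.[s] = 0) -> p = 0.
Proof.
move=> e0 hp; apply/eqP; apply: contraT => nz.
pose s := [seq e / k.+2%:R | k <- iota 0 (size p)].
have us : uniq s.
  rewrite map_inj_uniq ?iota_uniq // => k l /(mulfI (lt0r_neq0 e0))/invr_inj/eqP.
  by rewrite eqr_nat => /eqP[].
have rs : all (root p) s.
  apply/allP => x /mapP[k _ ->]; apply/eqP/hp.
  rewrite ger0_norm ?divr_ge0 ?(ltW e0) //.
  by rewrite ltr_pdivrMr // ltr_pMr // ltr1n.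
by have := max_poly_roots nz rs us; rewrite size_map size_iota ltnn.
Qed.

Section FormalDerivatives.
Context {R : realType} {n : nat}.
Notation E := 'rV[R]_n.
Notation jet := (('I_n -> nat) -> R).
Implicit Types (c : jet) (al : 'I_n -> nat) (a b w : E).

Definition shift (i : 'I_n) al : 'I_n -> nat := fun j => (al j + (j == i))%N.
Definition idx0 : 'I_n -> nat := fun=> 0%N.

(** The action of the derivative in direction [w] on Taylor data.  Indexing by
    multi-indices builds in the commutation of partial derivatives. *)
Definition jetder w c : jet := fun al => \sum_i w ord0 i * c (shift i al).

Lemma shiftC i j al : shift i (shift j al) = shift j (shift i al).
Proof. by apply/funext => k; rewrite /shift addnAC. Qed.

Lemma jetderC a b c : jetder a (jetder b c) = jetder b (jetder a c).
Proof.
apply/funext => al; rewrite /jetder.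
under eq_bigr do rewrite mulr_sumr; rewrite exchange_big /=.
apply: eq_bigr => i _; rewrite mulr_sumr; apply: eq_bigr => j _.
by rewrite shiftC mulrCA.
Qed.

Lemma jetder_linear w (k : R) c1 c2 : jetder w (k *: c1 + c2) = k *: jetder w c1 + jetder w c2.
Proof.
apply/funext => al; transitivity (k * jetder w c1 al + jetder w c2 al) => //.
rewrite /jetder mulr_sumr -big_split /=.
by apply: eq_bigr => i _; rewrite mulrDr mulrCA.
Qed.

Lemma jetderB w c1 c2 : jetder w (c1 - c2) = jetder w c1 - jetder w c2.
Proof. by rewrite addrC -scaleN1r jetder_linear scaleN1r addrC. Qed.

Lemma jetder_dir a b (s : R) c : jetder (a + s *: b) c = jetder a c + s *: jetder b c.
Proof.
apply/funext => al; transitivity (jetder a c al + s * jetder b c al) => //.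
rewrite /jetder mulr_sumr -big_split /=.
by apply: eq_bigr => i _; rewrite !mxE mulrDl mulrA.
Qed.

Lemma iter_jetderC a b d c : iter d (jetder a) (jetder b c) = jetder b (iter d (jetder a) c).
Proof. by elim: d => //= d ->; rewrite jetderC. Qed.

Lemma iter_jetder_linear w d k c1 c2 :
  iter d (jetder w) (k *: c1 + c2) = k *: iter d (jetder w) c1 + iter d (jetder w) c2.
Proof. by elim: d => //= d ->; rewrite jetder_linear. Qed.

Lemma iter_jetderB w d c1 c2 :
  iter d (jetder w) (c1 - c2) = iter d (jetder w) c1 - iter d (jetder w) c2.
Proof. by elim: d => //= d ->; rewrite jetderB. Qed.

(** The polynomial in s whose value is the d-th derivative of the jet [c] in the
    direction a + s b.  The recursion, one directional derivative at a time,
    avoids binomial expansions and makes degrees and divisibility by powers of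
    'X visible. *)
Fixpoint linepoly d c a b : {poly R} :=
  if d is d'.+1 then linepoly d' (jetder a c) a b + 'X * linepoly d' (jetder b c) a b
  else (c idx0)%:P.

Lemma size_linepoly d c a b : (size (linepoly d c a b) <= d.+1)%N.
Proof.
elim: d c => [|d IH] c /=; first exact: size_polyC_leq1.
rewrite (leq_trans (size_polyD _ _)) // geq_max (leq_trans (IH _)) //=.
rewrite (leq_trans (size_polyMleq _ _)) // size_polyX /=; exact: IH.
Qed.

Lemma linepoly_linear d k c1 c2 a b :
  linepoly d (k *: c1 + c2) a b = k *: linepoly d c1 a b + linepoly d c2 a b.
Proof.
elim: d c1 c2 => [|d IH] c1 c2 /=.
  by rewrite -mul_polyC -polyCM -polyCD.
by rewrite !jetder_linear !IH scalerDr mulrDr -scalerAr addrACA.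
Qed.

Lemma linepolyB d c1 c2 a b :
  linepoly d (c1 - c2) a b = linepoly d c1 a b - linepoly d c2 a b.
Proof. by rewrite addrC -scaleN1r linepoly_linear scaleN1r addrC. Qed.

Lemma horner_linepoly d c a b s :
  (linepoly d c a b).[s] = iter d (jetder (a + s *: b)) c idx0.
Proof.
elim: d c => [|d IH] c; first by rewrite hornerC.
rewrite iterSr /= !hornerE !IH jetder_dir [jetder a c + _]addrC iter_jetder_linear.
by rewrite [RHS]addrC.
Qed.

Lemma linepoly_shift d c a b s :
  linepoly d c a b \Po ('X + s%:P) = linepoly d c (a + s *: b) b.
Proof.
elim: d c => [|d IH] c /=; first by rewrite comp_polyC.
rewrite comp_polyD comp_polyM comp_polyX !IH jetder_dir [jetder a c + _]addrC.
by rewrite linepoly_linear -mul_polyC; ring.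
Qed.

(** Every factor 'X is paired with one derivative along [b]; a term with fewer
    than [e] of them is a combination of iterated derivatives along [a] of
    derivatives of order less than [e]. *)
Lemma dvdp_linepoly e d c a b :
  (forall al, (\sum_i al i < e)%N -> forall N, iter N (jetder a) c al = 0) ->
  'X^e %| linepoly d c a b.
Proof.
elim: d c e => [|d IH] c e hc /=.
  case: e hc => [|e] hc; first by rewrite expr0 dvd1p.
  by have := hc idx0 _ 0%N => /= ->; rewrite ?dvdp0 // big1.
apply: dvdp_add; first by apply: IH => al le N; rewrite -iterSr hc.
case: e hc => [|e] hc; first by rewrite expr0 dvd1p.
rewrite exprS dvdp_mul2l ?polyX_eq0 //; apply: IH => al le N.
rewrite iter_jetderC /jetder big1 // => i _; rewrite hc ?mulr0 //.
rewrite /shift big_split /= (bigD1 i) //= [X in (_ + X)%N](bigD1 i) //= eqxx.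
rewrite [X in (_ + (_ + X))%N]big1 => [|j /negbTE -> //].
by move: le; rewrite (bigD1 i) //=; lia.
Qed.

Lemma coef1_linepoly d c a b :
  (linepoly d.+1 c a b)`_1 = d.+1%:R * iter d (jetder a) (jetder b c) idx0.
Proof.
elim: d c => [|d IH] c.
  by rewrite /= coefD coefC add0r coefXM coefC mul1r.
have -> : linepoly d.+2 c a b =
  linepoly d.+1 (jetder a c) a b + 'X * linepoly d.+1 (jetder b c) a b by [].
rewrite coefD coefXM IH -[X in _ + X]horner_coef0 horner_linepoly scale0r addr0.
by rewrite jetderC -iterSr -[d.+2]addn1 natrD mulrDl mul1r.
Qed.

(** Openness along lines is all that the identity principle for polynomials
    in one variable requires. *)
Definition algebraically_open (P : set E) := forall w b, P w ->
  exists2 e : R, 0 < e & forall s, `|s| < e -> P (w + s *: b).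

(** If the d-th Taylor form vanishes at w + s b for all small s, its derivative in
    s vanishes at s = 0; it is d times the form of degree d - 1 of the
    derivative of the jet along [b].  Repeating this along coordinate directions
    reaches every partial derivative of order d. *)
Lemma polarization d c (P : set E) : P !=set0 -> algebraically_open P ->
  (forall w, P w -> iter d (jetder w) c idx0 = 0) ->
  forall al, (\sum_i al i = d)%N -> c al = 0.
Proof.
move=> [w0 Pw0] oP; elim: d c => [|d IH] c hc al hal.
  have -> : al = idx0; last exact: hc Pw0.
  by apply/funext => i; apply/eqP; move/eqP: hal; rewrite sum_nat_eq0 => /forallP/(_ i).
have [i ai] : exists i, (0 < al i)%N.
  apply/existsP; apply: contraPT hal; rewrite negb_exists => /forallP h.
  by rewrite big1 // => i _; move: (h i); rewrite -eqn0Ngt => /eqP.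
pose be j := (al j - (j == i))%N.
have alE : al = shift i be.
  by apply/funext => j; rewrite /shift /be; case: eqP => [->|_]; rewrite ?subn0 ?addn0 ?subnK.
have dc : jetder (delta_mx ord0 i) c = fun be => c (shift i be).
  apply/funext => ga; rewrite /jetder (bigD1 i) //= mxE !eqxx mul1r big1 ?addr0 // => j ne.
  by rewrite mxE eqxx (negbTE ne) mul0r.
rewrite alE -[LHS]/((fun be => c (shift i be)) be) -dc; apply: IH.
  move=> w Pw; have [e e0 he] := oP w (delta_mx ord0 i) Pw.
  have p0 : linepoly d.+1 c w (delta_mx ord0 i) = 0.
    by apply: (poly_eq0_near0 e0) => s se; rewrite horner_linepoly hc //; exact: he.
  have := coef1_linepoly d c w (delta_mx ord0 i); rewrite p0 coef0 => /esym/eqP.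
  by rewrite mulf_eq0 pnatr_eq0 /= => /eqP.
apply: succn_inj; rewrite -hal alE /shift big_split /= [X in (_ = _ + X)%N](bigD1 i) //= eqxx.
by rewrite [X in (_ = _ + (_ + X))%N]big1 ?addn0 ?addn1 // => j /negbTE ->.
Qed.

End FormalDerivatives.

(** * Mean value arguments in normed spaces *)

Section Calculus.
Context {R : realType} {E : normedModType R}.
Implicit Types (f g : E -> R) (x y u v w : E).

Lemma line_growth f y u (s : R) :
  (fun h : R => h^-1 *: (((fun t : R => f (y + t *: u)) \o +%R^~ s) (h *: 1) -
     f (y + s *: u))) =
  (fun h : R => h^-1 *: ((f \o +%R^~ (y + s *: u)) (h *: u) - f (y + s *: u))).
Proof.
apply/funext => h; congr (_ *: (_ - _)); rewrite /=; congr f.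
by rewrite scalerDl [h *: 1]mulr1 addrCA.
Qed.

Lemma line_derivable f y u (s : R) :
  derivable (fun t : R => f (y + t *: u)) s 1 = derivable f (y + s *: u) u.
Proof. by rewrite /derivable line_growth. Qed.

Lemma line_derive f y u (s : R) :
  'D_1 (fun t : R => f (y + t *: u)) s = 'D_u f (y + s *: u).
Proof. by rewrite /derive line_growth. Qed.

Lemma mvt_line f y u (t : R) :
  (forall s, `|s| <= `|t| -> derivable f (y + s *: u) u) ->
  exists2 s, `|s| <= `|t| & f (y + t *: u) - f y = t * 'D_u f (y + s *: u).
Proof.
move=> df; pose phi (s : R) := f (y + s *: u).
have phid (a b : R) : a <= b ->
    (forall s, a <= s <= b -> `|s| <= `|t|) ->
    exists2 c, a <= c <= b & phi b - phi a = 'D_u f (y + c *: u) * (b - a).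
  move=> ab hab.
  have dphi s : a <= s <= b -> is_derive s 1 phi ('D_u f (y + s *: u)).
    move=> /hab/df h; apply: DeriveDef; first by rewrite line_derivable.
    by rewrite line_derive.
  have [||c] := @MVT_segment R phi (fun s => 'D_u f (y + s *: u)) a b ab.
  - by move=> s; rewrite in_itv /= => /andP[s1 s2]; apply: dphi; rewrite !ltW.
  - apply: derivable_within_continuous => s; rewrite in_itv /= => /dphi hs.
    exact: ex_derive.
  - by rewrite in_itv /= => cab ce; exists c.
have p0 : phi 0 = f y by rewrite /phi scale0r addr0.
case: (lerP 0 t) => t0.
  have [s|c /andP[c1 c2] ce] := phid 0 t t0.
    by case/andP => s1 s2; rewrite !ger0_norm.
  by exists c; rewrite ?ger0_norm // -p0 mulrC; rewrite subr0 in ce.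
have [s|c /andP[c1 c2] ce] := phid t 0 (ltW t0).
  by case/andP => s1 s2; rewrite !ler0_norm ?lerN2 // ltW.
exists c; first by rewrite !ler0_norm ?lerN2 // ltW.
by rewrite -[LHS]opprB -p0 ce sub0r mulrN opprK mulrC.
Qed.

Lemma near_plane (P : E -> Prop) x u v : (\forall y \near x, P y) ->
  exists2 d : R, 0 < d & forall s t : R, `|s| < d -> `|t| < d -> P (x + s *: u + t *: v).
Proof.
(* The 1 keeps the quotient meaningful when u and v are 0. *)
move=> /nbhs_ballP[e /= e0 he]; exists (e / (1 + `|u| + `|v|)).
  by rewrite divr_gt0 // addrAC -addrA ltr_wpDr ?addr_ge0 // ltr01.
have D0 : 0 < 1 + `|u| + `|v| by rewrite -addrA ltr_pwDl ?addr_ge0.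
move=> s t; rewrite !ltr_pdivlMr // => hs ht; apply: he.
rewrite -ball_normE /ball_ /= -addrA opprD addrA subrr sub0r normrN.
apply: le_lt_trans (ler_normD _ _) _; rewrite !normrZ.
have us : `|s| * `|u| + `|t| * `|v| <= Num.max `|s| `|t| * (1 + `|u| + `|v|).
  have m1 : `|s| <= Num.max `|s| `|t| by rewrite le_max lexx.
  have m2 : `|t| <= Num.max `|s| `|t| by rewrite le_max lexx orbT.
  have m0 : 0 <= Num.max `|s| `|t| by apply: le_trans m1.
  have := ler_wpM2r (normr_ge0 u) m1; have := ler_wpM2r (normr_ge0 v) m2.
  move: m0; lra.
apply: le_lt_trans us _; case: (leP `|s| `|t|) => //.
Qed.

(** A direction in which the derivative exists nearby and is continuous can be
    added to any direction of differentiability: apply the mean value theorem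
    from x + h w to x + h w + h c u.  Summing coordinate directions, a C^1
    function has all directional derivatives, without total differentiability
    having to be discussed. *)
Lemma is_derive_add_dir f x w u (c : R) : derivable f x w ->
  (\forall y \near x, derivable f y u) -> {for x, continuous ('D_u f)} ->
  is_derive x (w + c *: u) f ('D_w f x + c * 'D_u f x).
Proof.
move=> fw fu cu.
suff H : (fun h => h^-1 *: ((f \o +%R^~ x) (h *: (w + c *: u)) - f x)) @ 0^' -->
     ('D_w f x + c * 'D_u f x).
  apply: DeriveDef; first by apply/cvg_ex; eexists; exact: H.
  exact/cvg_lim.
have split h : h^-1 *: ((f \o +%R^~ x) (h *: (w + c *: u)) - f x) =
   h^-1 *: ((f \o +%R^~ x) (h *: w) - f x) +
   h^-1 *: (f (x + h *: w + (h * c) *: u) - f (x + h *: w)).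
  rewrite -scalerDr /=; congr (_ *: _).
  rewrite [x + h *: w]addrC.
  have -> : h *: (w + c *: u) + x = h *: w + x + (h * c) *: u.
    by rewrite scalerDr scalerA addrAC.
  ring.
under eq_fun do rewrite split.
apply: cvgD; first exact: fw.
apply/cvgrPdist_lt => e e0.
have e1 : 0 < e / (1 + `|c|) by rewrite divr_gt0 // ltr_pwDl.
have [d d0 hd] : exists2 d : R, 0 < d & forall s t : R, `|s| < d -> `|t| < d ->
    derivable f (x + s *: w + t *: u) u /\
    `|'D_u f x - 'D_u f (x + s *: w + t *: u)| < e / (1 + `|c|).
  apply: (@near_plane (fun y => derivable f y u /\
    `|'D_u f x - 'D_u f y| < e / (1 + `|c|))); near=> y; split; first by near: y.
  by near: y; move/cvgrPdist_lt: cu => /(_ _ e1).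
near=> h.
have hd' : `|h| < d / (1 + `|c|).
  near: h; apply: dnbhs0_lt; by rewrite divr_gt0 // ltr_pwDl.
have c1 : 0 < 1 + `|c| by rewrite ltr_pwDl.
rewrite ltr_pdivlMr // in hd'.
have h1 : `|h| < d.
  by apply: le_lt_trans hd'; rewrite ler_peMr // lerDl.
have h2 : `|h * c| < d.
  by rewrite normrM; apply: le_lt_trans hd'; rewrite ler_wpM2l // lerDr.
have [|t ht ->] := @mvt_line f (x + h *: w) u (h * c).
  by move=> s hs; have [] := hd h s h1 (le_lt_trans hs h2).
have h0 : h != 0 by near: h; exact: nbhs_dnbhs_neq.
rewrite -[_ *: _]/(_ * _) !mulrA mulVf // mul1r -mulrBr normrM.
have [_ hh] := hd h t h1 (le_lt_trans ht h2).
rewrite ltr_pdivlMr // mulrDr mulr1 in hh.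
apply: le_lt_trans hh; rewrite mulrC lerDr //.
Unshelve. all: by end_near. Qed.

(** Apply the mean value theorem along [u] to y |-> f (y + h v) - f y, and then
    along [v]. *)
Lemma mixed_difference f x u v (h : R) :
  (forall s t, `|s| <= `|h| -> `|t| <= `|h| ->
     derivable f (x + s *: u + t *: v) u /\
     derivable ('D_u f) (x + s *: u + t *: v) v) ->
  exists s t, [/\ `|s| <= `|h|, `|t| <= `|h| &
   f (x + h *: u + h *: v) - f (x + h *: u) - f (x + h *: v) + f x =
   h * (h * 'D_v ('D_u f) (x + s *: u + t *: v))].
Proof.
move=> H; pose g y := f (y + h *: v) - f y.
have shiftf y : derivable f (y + h *: v) u ->
    is_derive y u (fun z => f (z + h *: v)) ('D_u f (y + h *: v)).
  have E1 : (fun k : R => k^-1 *: (((fun z => f (z + h *: v)) \o +%R^~ y) (k *: u) -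
         f (y + h *: v))) =
     (fun k : R => k^-1 *: ((f \o +%R^~ (y + h *: v)) (k *: u) - f (y + h *: v))).
    by apply/funext => k /=; rewrite addrA.
  by move=> d; apply: DeriveDef; rewrite /derivable /derive E1.
have gd (s : R) : `|s| <= `|h| -> is_derive (x + s *: u) u g
    ('D_u f (x + s *: u + h *: v) - 'D_u f (x + s *: u)).
  move=> hs; have h1 := shiftf _ (H s h hs (lexx _)).1.
  have h2 : derivable f (x + s *: u) u.
    have h00 : `|0 : R| <= `|h| by rewrite normr0.
    by have := (H s 0 hs h00).1; rewrite scale0r addr0.
  by apply: is_deriveB => //; exact: derivableP.
have [|s hs] := @mvt_line g x u h; first by move=> s hs; have := gd s hs => -[].
have := gd s hs => -[_ ->] gE.
have [|t ht] := @mvt_line ('D_u f) (x + s *: u) v h.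
  by move=> t ht; have [] := H s t hs ht.
move=> fE; exists s, t; split => //; rewrite -fE -gE /g; ring.
Qed.

(** The second difference of [f] is symmetric in [u] and [v], so a value of one
    mixed derivative equals a value of the other, at points arbitrarily close
    to [x]. *)
Lemma schwarz f x u v :
  (\forall y \near x, derivable f y u /\ derivable f y v) ->
  (\forall y \near x, derivable ('D_u f) y v /\ derivable ('D_v f) y u) ->
  {for x, continuous ('D_v ('D_u f))} -> {for x, continuous ('D_u ('D_v f))} ->
  'D_v ('D_u f) x = 'D_u ('D_v f) x.
Proof.
move=> d1 d2 c1 c2; apply/eqP; rewrite -subr_eq0 -normr_eq0.
rewrite eq_le normr_ge0 andbT; apply/ler_addgt0Pl => e e0; rewrite addr0.
have e2 : 0 < e / 2 by rewrite divr_gt0.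
pose P y := [/\ derivable f y u /\ derivable f y v,
   derivable ('D_u f) y v /\ derivable ('D_v f) y u,
   `|'D_v ('D_u f) x - 'D_v ('D_u f) y| < e / 2 &
   `|'D_u ('D_v f) x - 'D_u ('D_v f) y| < e / 2].
have nP : \forall y \near x, P y.
  have c1' : \forall y \near x, `|'D_v ('D_u f) x - 'D_v ('D_u f) y| < e / 2.
    by move/cvgrPdist_lt: c1 => /(_ _ e2).
  have c2' : \forall y \near x, `|'D_u ('D_v f) x - 'D_u ('D_v f) y| < e / 2.
    by move/cvgrPdist_lt: c2 => /(_ _ e2).
  by apply: filterS (filterI (filterI d1 d2) (filterI c1' c2')) => y [[? ?] [? ?]].
have [d d0 hd] := near_plane u v nP.
have [d' d'0 hd'] := near_plane v u nP.
pose h := Num.min d d' / 2.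
have m0 : 0 < Num.min d d' by rewrite lt_min d0.
have h0 : 0 < h by rewrite divr_gt0.
have hm : h < Num.min d d' by rewrite ltr_pdivrMr // ltr_pMr // ltr1n.
have [hh hh'] : `|h| < d /\ `|h| < d'.
  by rewrite ger0_norm ?ltW //; move: hm; rewrite lt_min => /andP[].
have [|s [t [hs ht E1]]] := @mixed_difference f x u v h.
  move=> s t hs ht.
  have [[a1 _] [a2 _] _ _] := hd s t (le_lt_trans hs hh) (le_lt_trans ht hh).
  exact: conj a1 a2.
have [|s' [t' [hs' ht' E2]]] := @mixed_difference f x v u h.
  move=> a b ha hb.
  have [[_ a1] [_ a2] _ _] := hd' a b (le_lt_trans ha hh') (le_lt_trans hb hh').
  exact: conj a1 a2.
have : h * (h * 'D_v ('D_u f) (x + s *: u + t *: v)) =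
       h * (h * 'D_u ('D_v f) (x + s' *: v + t' *: u)).
  rewrite -[LHS]E1 -[RHS]E2 [x + h *: v + h *: u]addrAC.
  by congr (_ + _); rewrite [LHS]addrAC.
have hn0 : h != 0 by rewrite gt_eqF.
move=> /(mulfI hn0)/(mulfI hn0) eqD.
have [_ _ p1 _] := hd s t (le_lt_trans hs hh) (le_lt_trans ht hh).
have [_ _ _ p2] := hd' s' t' (le_lt_trans hs' hh') (le_lt_trans ht' hh').
rewrite eqD in p1; move: p1 p2.
move: ('D_u _ (x + _ + _)) ('D_v _ x) ('D_u _ x) => A B C p1 p2.
apply: ltW; rewrite [e]splitr -[B](subrK A) -addrA.
by apply: le_lt_trans (ler_normD _ _) (ltrD p1 _); rewrite distrC.
Qed.

End Calculus.

(** * Smooth functions and directional derivatives *)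

Section Smooth.
Context {R : realType} {n : nat}.
Notation E := 'rV[R]_n.
Implicit Types (f g : E -> R) (U : set E) (x w : E).

Lemma near_open U (P : E -> Prop) x : open U -> U x -> (forall y, U y -> P y) ->
  \forall y \near x, P y.
Proof. by move=> oU Ux UP; apply: filterS (open_nbhs_nbhs (conj oU Ux)) => y /UP. Qed.

Lemma pderivs_cat s t f : pderivs (s ++ t) f = pderivs s (pderivs t f).
Proof. exact: foldr_cat. Qed.

Lemma smooth_pderivs U f s : smooth_on U f -> smooth_on U (pderivs s f).
Proof. by move=> sf t x Ux; rewrite -pderivs_cat; exact: sf. Qed.

Lemma smooth_pderiv U f i : smooth_on U f -> smooth_on U (pderiv i f).
Proof. exact: (@smooth_pderivs U f [:: i]). Qed.

Lemma smooth_derivable U f i x : smooth_on U f -> U x -> derivable f x (delta_mx ord0 i).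
Proof. by move=> /(_ [::]) sf /sf[_]; exact. Qed.

Lemma smooth_continuous U f x : smooth_on U f -> U x -> {for x, continuous f}.
Proof. by move=> /(_ [::]) sf /sf[]. Qed.

Lemma eq_pderivs U f g s x : open U -> (forall y, U y -> f y = g y) -> U x ->
  pderivs s f x = pderivs s g x.
Proof.
move=> oU fg; elim: s x => [|i s IH] x Ux /=; first exact: fg.
rewrite /pderiv; apply: near_eq_derive; apply: near_open Ux _ => //.
Qed.

Lemma pderivs_linear U f g (k : R) s x : open U -> smooth_on U f -> smooth_on U g ->
  U x -> pderivs s (k *: f + g) x = k * pderivs s f x + pderivs s g x.
Proof.
move=> oU sf sg; elim: s x => [|i s IH] x Ux //=.
rewrite /pderiv (near_eq_derive (g := k *: pderivs s f + pderivs s g)); last first.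
  by apply: near_open Ux _.
have df := (sf s x Ux).2 i; have dg := (sg s x Ux).2 i.
by rewrite (deriveD (@derivableZ _ _ _ _ k _ _ df) dg) (deriveZ k df).
Qed.

Lemma smooth_linear U f g (k : R) : open U -> smooth_on U f -> smooth_on U g ->
  smooth_on U (k *: f + g).
Proof.
move=> oU sf sg s x Ux.
have nE : {near x, k *: pderivs s f + pderivs s g =1 pderivs s (k *: f + g)}.
  by apply: near_open Ux _ => // y Uy; rewrite (pderivs_linear k s oU sf sg Uy).
have [cf df] := sf s x Ux; have [cg dg] := sg s x Ux.
split=> [|i]; last first.
  by apply: near_eq_derivable nE _; apply: derivableD => //; exact: derivableZ.
rewrite /prop_for /continuous_at (pderivs_linear k s oU sf sg Ux).
apply: cvg_trans; first exact: (@near_eq_cvg _ _ (nbhs x) _ _ _ nE).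
by apply: cvgD => //; apply: cvgZr.
Qed.

Lemma smooth0 U : smooth_on U 0.
Proof.
move=> s x _; have -> : pderivs s 0 = 0 :> (E -> R).
  by elim: s => //= i s ->; apply/funext => y; rewrite /pderiv (derive_cst (0 : R)).
by split=> [|i]; [exact: cst_continuous|exact: (derivable_cst (0 : R))].
Qed.

Lemma smoothB U f g : open U -> smooth_on U f -> smooth_on U g -> smooth_on U (f - g).
Proof. by move=> *; rewrite addrC -scaleN1r; apply: smooth_linear. Qed.

Lemma pderivsB U f g s x : open U -> smooth_on U f -> smooth_on U g -> U x ->
  pderivs s (f - g) x = pderivs s f x - pderivs s g x.
Proof.
by move=> oU sf sg Ux; rewrite addrC -scaleN1r (pderivs_linear _ _ oU) // mulN1r addrC.
Qed.

Lemma smooth_lincomb U (F : 'I_n -> E -> R) (w : E) (r : seq 'I_n) : open U ->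
  (forall i, smooth_on U (F i)) ->
  smooth_on U (\sum_(i <- r) w ord0 i *: F i) /\
  forall s x, U x -> pderivs s (\sum_(i <- r) w ord0 i *: F i) x =
     \sum_(i <- r) w ord0 i * pderivs s (F i) x.
Proof.
move=> oU sF; elim: r => [|i r [IH1 IH2]].
  rewrite big_nil; split; first exact: smooth0.
  move=> s x _; rewrite big_nil; have -> : pderivs s 0 = 0 :> (E -> R) => //.
  by elim: s => //= i s ->; apply/funext => y; rewrite /pderiv (derive_cst (0 : R)).
rewrite big_cons; split; first exact: (smooth_linear _ oU (sF i) IH1).
by move=> s x Ux; rewrite (pderivs_linear _ _ oU (sF i) IH1 Ux) (IH2 s x Ux) big_cons.
Qed.

Definition dirder w f : E -> R := \sum_i w ord0 i *: pderiv i f.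

Lemma dirderE w f x : dirder w f x = \sum_i w ord0 i * pderiv i f x.
Proof. by rewrite /dirder fct_sumE. Qed.

Lemma smooth_dirder U w f : open U -> smooth_on U f -> smooth_on U (dirder w f).
Proof. by move=> oU sf; case: (smooth_lincomb w (index_enum _) oU (fun i => smooth_pderiv i sf)). Qed.

Lemma smooth_iter_dirder U w f N : open U -> smooth_on U f -> smooth_on U (iter N (dirder w) f).
Proof. by move=> oU sf; elim: N => [|N IH]; [exact: sf|exact: (smooth_dirder w oU IH)]. Qed.

Lemma is_derive_dirder U w f x : open U -> smooth_on U f -> U x -> is_derive x w f (dirder w f x).
Proof.
move=> oU sf Ux; rewrite dirderE {1}[w]row_sum_delta.
elim: (index_enum _) => [|i r IH]; first by rewrite !big_nil; exact: is_derive0.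
rewrite !big_cons addrC [X in is_derive _ _ _ X]addrC.
have -> : \sum_(i <- r) w ord0 i * pderiv i f x =
          'D_(\sum_(i <- r) w ord0 i *: delta_mx ord0 i) f x.
  by rewrite (@derive_val _ _ _ _ _ _ _ IH).
apply: is_derive_add_dir.
- exact: ex_derive.
- by apply: near_open Ux _ => // y; exact: smooth_derivable.
- by apply: smooth_continuous Ux; exact: smooth_pderiv sf.
Qed.

Lemma pderivC U f i j x : open U -> smooth_on U f -> U x ->
  pderiv i (pderiv j f) x = pderiv j (pderiv i f) x.
Proof.
move=> oU sf Ux; apply: (@schwarz R E f x (delta_mx ord0 j) (delta_mx ord0 i)).
- by apply: (near_open oU Ux) => y Uy; split; exact: smooth_derivable sf Uy.
- apply: (near_open oU Ux) => y Uy.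
  split; first exact: (smooth_derivable (@smooth_pderiv U f j sf) Uy).
  exact: (smooth_derivable (@smooth_pderiv U f i sf) Uy).
- exact: (sf [:: i; j] x Ux).1.
- exact: (sf [:: j; i] x Ux).1.
Qed.

(** Lets iterated partial derivatives be reordered at will; together with
    [count_word] it reduces any word of derivatives to its multi-index. *)
Lemma perm_pderivs U f s t x : open U -> smooth_on U f -> U x -> perm_eq s t ->
  pderivs s f x = pderivs t f x.
Proof.
move=> oU sf Ux; elim: s t x Ux => [|i s IH] t x Ux.
  by rewrite perm_sym => /perm_nilP ->.
move=> pt; have it : i \in t by rewrite -(perm_mem pt) mem_head.
case/splitPr: it pt => t1 t2.
rewrite perm_sym -[i :: t2]cat1s perm_catCA perm_cons perm_sym => pt.
have front : forall y, U y -> pderivs (t1 ++ i :: t2) f y = pderivs (i :: t1 ++ t2) f y.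
  elim: t1 {pt} => [|k t1 IH1] // y Uy.
  transitivity (pderivs [:: k; i] (pderivs (t1 ++ t2) f) y).
    apply: (@eq_pderivs U (pderivs (t1 ++ i :: t2) f) (pderivs (i :: t1 ++ t2) f) [:: k]) => //.
  exact: (pderivC k i oU (@smooth_pderivs U f (t1 ++ t2) sf) Uy).
rewrite front // /=.
by apply: (@eq_pderivs U (pderivs s f) (pderivs (t1 ++ t2) f) [:: i]) => // y Uy; exact: IH.
Qed.

Definition word (al : 'I_n -> nat) : seq 'I_n := flatten [seq nseq (al i) i | i <- enum 'I_n].

Lemma count_word al k : count_mem k (word al) = al k.
Proof.
rewrite /word count_flatten -map_comp sumnE big_map enumT /=.
have -> : \sum_(j <- Finite.enum 'I_n) (count_mem k \o (fun i => nseq (al i) i)) j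
    = \sum_(j : 'I_n) count_mem k (nseq (al j) j) by rewrite /index_enum unlock.
rewrite (bigD1 k) //= count_nseq /= eqxx mul1n -[RHS]addn0; congr addn.
by rewrite big1 // => j /negbTE jk; rewrite count_nseq /= jk mul0n.
Qed.

Lemma perm_count (s t : seq 'I_n) : (forall k, count_mem k s = count_mem k t) -> perm_eq s t.
Proof. by move=> h; apply/allP => k _ /=; rewrite h. Qed.

Lemma mderiv_idx0 f : mderiv idx0 f = f.
Proof.
rewrite /mderiv; have -> // : flatten [seq nseq (idx0 i) i | i <- enum 'I_n] = [::].
by elim: (enum _).
Qed.

Lemma mderiv_shift U f i al x : open U -> smooth_on U f -> U x ->
  mderiv al (pderiv i f) x = mderiv (shift i al) f x.
Proof.
move=> oU sf Ux; rewrite -[LHS]/(pderivs (word al) (pderivs [:: i] f) x) -pderivs_cat.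
apply: (@perm_pderivs U) => //; apply: perm_count => k.
by rewrite -[X in _ = count _ X]/(word _) count_cat !count_word /= addn0 eq_sym.
Qed.

Lemma mderiv_mderiv U f al be x : open U -> smooth_on U f -> U x ->
  mderiv al (mderiv be f) x = mderiv (fun k => al k + be k)%N f x.
Proof.
move=> oU sf Ux; rewrite -[LHS]/(pderivs (word al) (pderivs (word be) f) x) -pderivs_cat.
apply: (@perm_pderivs U) => //; apply: perm_count => k.
by rewrite -[X in _ = count _ X]/(word _) count_cat !count_word.
Qed.

Lemma smooth_mderiv U f al : smooth_on U f -> smooth_on U (mderiv al f).
Proof. exact: smooth_pderivs. Qed.

Definition jet f x : ('I_n -> nat) -> R := fun al => mderiv al f x.

Lemma jet_dirder U w f x : open U -> smooth_on U f -> U x ->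
  jet (dirder w f) x = jetder w (jet f x).
Proof.
move=> oU sf Ux; apply/funext => al.
have [_ /(_ (word al) x Ux)] :=
  smooth_lincomb w (index_enum _) oU (fun i => smooth_pderiv i sf).
rewrite -[X in X = _ -> _]/(jet (dirder w f) x al) => ->.
by apply: eq_bigr => i _; congr (_ * _); exact: (@mderiv_shift U).
Qed.

Lemma jet_iter_dirder U w f x N : open U -> smooth_on U f -> U x ->
  jet (iter N (dirder w) f) x = iter N (jetder w) (jet f x).
Proof.
move=> oU sf Ux; elim: N => [|N IH] //; rewrite !iterS -IH.
exact: (jet_dirder w oU (smooth_iter_dirder w N oU sf) Ux).
Qed.

Lemma iter_jetder_jet0 U w f x N : open U -> smooth_on U f -> U x ->
  iter N (jetder w) (jet f x) idx0 = iter N (dirder w) f x.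
Proof. by move=> oU sf Ux; rewrite -(jet_iter_dirder w N oU) // /jet mderiv_idx0. Qed.

(** Taylor data may be read at [al] either before or after differentiating the
    function along [w]. *)
Lemma iter_jetder_jet U w f x N al : open U -> smooth_on U f -> U x ->
  iter N (jetder w) (jet f x) al = iter N (dirder w) (mderiv al f) x.
Proof.
move=> oU sf Ux.
have tr c : iter N (jetder w) c al =
    iter N (jetder w) (fun be => c (fun k => be k + al k)%N) idx0.
  suff -> : iter N (jetder w) (fun be => c (fun k => be k + al k)%N) =
     (fun be => iter N (jetder w) c (fun k => be k + al k)%N) by congr (iter _ _ _ _).
  elim: N => [|N IH] //; rewrite iterS IH; apply/funext => be.
  apply: eq_bigr => i _; congr (_ * _); congr (iter N (jetder w) c).
  by apply/funext => k; rewrite /shift addnAC.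
rewrite tr -(iter_jetder_jet0 w N oU (@smooth_mderiv U f al sf) Ux).
congr (iter _ _ _ _); apply/funext => be; by rewrite /jet (@mderiv_mderiv U).
Qed.

Lemma jetB U f g x : open U -> smooth_on U f -> smooth_on U g -> U x ->
  jet (f - g) x = jet f x - jet g x.
Proof. by move=> *; apply/funext => al; exact: (@pderivsB U). Qed.

(** The derivative along [q] is computed from the right, so it is enough that one
    can move a little from each point of [Z] in the direction [q], as is the case
    for a convex cone with vertex on its boundary. *)
Lemma dirder_eq0 U f (Z : set E) q : open U -> smooth_on U f -> Z `<=` U ->
  (forall x, Z x -> exists2 e : R, 0 < e & forall s, 0 < s < e -> Z (x + s *: q)) ->
  (forall x, Z x -> f x = 0) -> forall x, Z x -> dirder q f x = 0.
Proof.
move=> oU sf ZU Zq f0 x Zx.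
have [df <-] := is_derive_dirder q oU sf (ZU _ Zx).
have := cvg_at_rightE _ _ df; rewrite -[X in X = _]/('D_q f x) => ->.
apply: cvg_lim => //.
have [e e0 he] := Zq x Zx.
apply: (@cvg_trans _ ((fun=> 0 : R) @ at_right (0 : R))); last exact: cvg_cst.
apply: near_eq_cvg; near=> s => /=.
have s0 : 0 < s by near: s; exact: nbhs_right_gt.
have se : s < e by near: s; exact: nbhs_right_lt.
have Zs : Z (x + s *: q) by apply: he; rewrite s0.
by rewrite (f0 x Zx) [s *: q + x]addrC (f0 _ Zs) subr0 scaler0.
Unshelve. all: by end_near. Qed.

Lemma dirder_dir a b (s : R) f x : dirder (a + s *: b) f x = dirder a f x + s * dirder b f x.
Proof.
rewrite !dirderE mulr_sumr -big_split /=.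
by apply: eq_bigr => i _; rewrite !mxE mulrDl mulrA.
Qed.

Lemma iter_dirder_line h x w (p : {poly R}) N : smooth_on setT h ->
  (forall s, h (x + s *: w) = p.[s]) ->
  forall s, iter N (dirder w) h (x + s *: w) = p^`(N).[s].
Proof.
move=> sh; elim: N p h sh => [|N IH] p h sh hp s; first exact: hp.
rewrite iterSr derivSn; apply: IH; first by apply: smooth_dirder => //; exact: openT.
move=> t; have [_ <-] := is_derive_dirder w openT sh (I : setT (x + t *: w)).
rewrite -line_derive derivE derive1E.
by have -> : (fun u : R => h (x + u *: w)) = horner p by apply/funext => u; exact: hp.
Qed.

End Smooth.

(** * Polynomial functions *)

Section PolynomialFunctions.
Context {R : realType} {n : nat}.
Notation E := 'rV[R]_n.

(** An inductive class rather than a type of multivariate polynomials, since only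
    closure under partial derivatives is needed for smoothness. *)
Inductive polyfun : (E -> R) -> Prop :=
| polyfun_cst c : polyfun (cst c)
| polyfun_coord i : polyfun (fun x => x ord0 i)
| polyfunD f g : polyfun f -> polyfun g -> polyfun (f + g)
| polyfunM f g : polyfun f -> polyfun g -> polyfun (f * g).

Lemma polyfun_differentiable f x : polyfun f -> differentiable f x.
Proof.
elim=> [c|i|f1 g1 _ df _ dg|f1 g1 _ df _ dg].
- exact: differentiable_cst.
- exact: differentiable_coord.
- exact: differentiableD.
- exact: differentiableM.
Qed.

Lemma polyfun_pderiv f i : polyfun f -> polyfun (pderiv i f).
Proof.
have D g y : polyfun g -> derivable g y (delta_mx ord0 i).
  by move=> pg; exact: diff_derivable (polyfun_differentiable y pg).
elim=> [c|j|f1 g1 pf df pg dg|f1 g1 pf df pg dg].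
- have -> : pderiv i (cst c) = cst 0 by apply/funext => x; exact: derive_cst.
  exact: polyfun_cst.
- have -> : pderiv i (fun x : E => x ord0 j) = cst (i == j)%:R.
    apply/funext => x; rewrite /pderiv.
    pose p : {poly R} := (x ord0 j)%:P + (i == j)%:R *: 'X.
    rewrite -[in LHS](addr0 x) -[in LHS](scale0r (delta_mx ord0 i)) -line_derive.
    have -> : (fun t : R => (x + t *: delta_mx ord0 i) ord0 j) = horner p.
      apply/funext => t; rewrite !mxE eqxx /= hornerD hornerC hornerZ hornerX.
      by rewrite eq_sym mulrC.
    rewrite -derive1E -derivE derivD derivC derivZ derivX add0r hornerZ.
    by rewrite hornerC mulr1.
  exact: polyfun_cst.
- have -> : pderiv i (f1 + g1) = pderiv i f1 + pderiv i g1.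
    by apply/funext => x; exact: (deriveD (D _ x pf) (D _ x pg)).
  exact: polyfunD.
- have -> : pderiv i (f1 * g1) = f1 * pderiv i g1 + g1 * pderiv i f1.
    by apply/funext => x; exact: (deriveM (D _ x pf) (D _ x pg)).
  by apply: polyfunD; apply: polyfunM.
Qed.

Lemma polyfun_smooth f U : polyfun f -> smooth_on U f.
Proof.
move=> pf s x _; have ps : polyfun (pderivs s f).
  by elim: s => [|i s IH] //; exact: polyfun_pderiv.
have dx := polyfun_differentiable x ps.
split; first exact: differentiable_continuous.
by move=> i; exact: diff_derivable.
Qed.

Lemma polyfun_sum (I : Type) (r : seq I) (F : I -> E -> R) :
  (forall i, polyfun (F i)) -> polyfun (fun x => \sum_(i <- r) F i x).
Proof.
move=> pF; elim: r => [|i r IH].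
  have -> : (fun x => \sum_(i <- [::]) F i x) = cst 0.
    by apply/funext => x; rewrite big_nil.
  exact: polyfun_cst.
have -> : (fun x => \sum_(j <- i :: r) F j x) = F i + (fun x => \sum_(j <- r) F j x).
  by apply/funext => x; rewrite big_cons.
exact: polyfunD.
Qed.

Lemma polyfunX f k : polyfun f -> polyfun (fun x => f x ^+ k).
Proof.
move=> pf; elim: k => [|k IH].
  have -> : (fun x => f x ^+ 0) = cst 1 by apply/funext => x; rewrite expr0.
  exact: polyfun_cst.
have -> : (fun x => f x ^+ k.+1) = f * (fun x => f x ^+ k).
  by apply/funext => x; rewrite exprS.
exact: polyfunM.
Qed.

(** Univariate polynomials whose coefficients are polynomial functions of a point
    and whose degrees are bounded uniformly, so that evaluating them is a finite
    sum. *)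
Definition polyfam (p : E -> {poly R}) :=
  (exists N, forall x, (size (p x) <= N)%N) /\ forall k, polyfun (fun x => (p x)`_k).

Lemma polyfam_cst q : polyfam (cst q).
Proof. by split; [exists (size q)|move=> k; exact: (polyfun_cst q`_k)]. Qed.

Lemma polyfamM p q : polyfam p -> polyfam q -> polyfam (fun x => p x * q x).
Proof.
move=> [[N hN] hp] [[M hM] hq]; split.
  exists (N + M)%N => x; apply: leq_trans (size_polyMleq _ _) _.
  by apply: leq_trans (leq_pred _) _; rewrite leq_add.
move=> k; have -> : (fun x => (p x * q x)`_k) =
   (fun x => \sum_(j < k.+1) ((fun x => (p x)`_j) * (fun x => (q x)`_(k - j))) x).
  by apply/funext => x; rewrite coefM.
by apply: polyfun_sum => j; exact: polyfunM.
Qed.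

Lemma polyfam_prod (I : Type) (r : seq I) (P : I -> E -> {poly R}) :
  (forall i, polyfam (P i)) -> polyfam (fun x => \prod_(i <- r) P i x).
Proof.
move=> pP; elim: r => [|i r IH].
  have -> : (fun x => \prod_(i <- [::]) P i x) = cst 1.
    by apply/funext => x; rewrite big_nil.
  exact: polyfam_cst.
have -> : (fun x => \prod_(j <- i :: r) P j x) = (fun x => P i x * \prod_(j <- r) P j x).
  by apply/funext => x; rewrite big_cons.
exact: polyfamM.
Qed.

Lemma polyfamX p k : polyfam p -> polyfam (fun x => p x ^+ k).
Proof.
move=> pp; elim: k => [|k IH].
  by under eq_fun do rewrite expr0; exact: polyfam_cst.
by under eq_fun do rewrite exprS; exact: polyfamM.
Qed.

Lemma polyfam_XsubC y : polyfun y -> polyfam (fun x => 'X - (y x)%:P).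
Proof.
move=> py; split; first by exists 2 => x; rewrite size_XsubC.
case=> [|k].
  have -> : (fun x => ('X - (y x)%:P)`_0) = cst (-1) * y.
    by apply/funext => x; rewrite coefB coefX coefC /= sub0r -[LHS]mulN1r.
  by apply: polyfunM => //; exact: polyfun_cst.
have -> : (fun x => ('X - (y x)%:P)`_k.+1) = cst (k == 0)%:R.
  by apply/funext => x; rewrite coefB coefX coefC /= subr0.
exact: polyfun_cst.
Qed.

Lemma polyfun_horner_prim p z : polyfam p -> polyfun z ->
  polyfun (fun x => (prim (p x)).[z x]).
Proof.
move=> [[N hN] hp] pz.
have -> : (fun x => (prim (p x)).[z x]) =
  (fun x => \sum_(k < N.+1) ((fun x => (prim (p x))`_k) * (fun x => z x ^+ k)) x).
  apply/funext => x; rewrite (@horner_coef_wide _ N.+1) //.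
  by apply: leq_trans (size_poly _ _) _; rewrite ltnS.
apply: polyfun_sum => i; apply: polyfunM; last exact: polyfunX.
case: (nat_of_ord i) => [|k].
  have -> : (fun x => (prim (p x))`_0) = cst 0 by apply/funext => x; rewrite coef_prim.
  exact: polyfun_cst.
have -> : (fun x => (prim (p x))`_k.+1) = (fun x => (p x)`_k) * cst (k.+1%:R^-1).
  by apply/funext => x; rewrite coef_prim.
by apply: polyfunM => //; exact: polyfun_cst.
Qed.

Lemma polyfun_prim_weight m w t (y : 'I_m.+1 -> E -> R) z :
  (forall l, polyfun (y l)) -> polyfun z ->
  polyfun (fun x => (prim (weight_poly w t (fun l => y l x))).[z x]).
Proof.
move=> py; apply: polyfun_horner_prim.
apply: polyfamM; last exact: polyfam_cst.
by apply: polyfam_prod => l; apply: polyfamX; exact: polyfam_XsubC.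
Qed.

Lemma polyfun_linear (v : E) m (B : 'M[R]_(n, m)) k : polyfun (fun x => ((x - v) *m B) ord0 k).
Proof.
have -> : (fun x : E => ((x - v) *m B) ord0 k) =
  (fun x => \sum_j (((fun x : E => x ord0 j) + cst (- v ord0 j)) * cst (B j k)) x).
  by apply/funext => x; rewrite mxE; apply: eq_bigr => j _; rewrite !mxE.
apply: polyfun_sum => j; apply: polyfunM; last exact: polyfun_cst.
by apply: polyfunD; [exact: polyfun_coord|exact: polyfun_cst].
Qed.

End PolynomialFunctions.

(** * Simplices, their vertices and facets *)

Section Convexity.
Context {R : realType} {n : nat}.
Notation E := 'rV[R]_n.

Lemma convex_setP (S : set E) : @convex_set R E S <->
  (forall x y (t : R), 0 <= t -> t <= 1 -> S x -> S y -> S (t *: x + (1 - t) *: y)).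
Proof.
split=> [cS x y t t0 t1 Sx Sy|cS x y t].
  by have := cS x y (Itv01 t0 t1); rewrite !inE; exact.
by rewrite !inE => Sx Sy; apply: (cS x y t%:num) => //.
Qed.

(** The normalization by the sum of the coefficients makes the statement
    provable by induction on the list: each step is one binary combination. *)
Lemma convex_comb_in (S : set E) (I : Type) (r : seq I) (c : I -> R) (p : I -> E) :
  @convex_set R E S -> (forall k, 0 <= c k) -> (forall k, c k != 0 -> S (p k)) ->
  0 < \sum_(k <- r) c k -> S ((\sum_(k <- r) c k)^-1 *: \sum_(k <- r) c k *: p k).
Proof.
move=> /convex_setP cS c0 cp; elim: r => [|k r IH]; first by rewrite big_nil ltxx.
rewrite !big_cons; set s := \sum_(j <- r) c j in IH *.
set P := \sum_(j <- r) _ in IH *.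
have s0 : 0 <= s by apply: sumr_ge0.
have [sE|sn] := eqVneq s 0.
  have PE : P = 0.
    move: sE; rewrite /s /P; elim: (r) => [|j t IHt]; first by rewrite !big_nil.
    rewrite !big_cons => /eqP; rewrite paddr_eq0 ?sumr_ge0 // => /andP[/eqP -> /eqP/IHt ->].
    by rewrite scale0r addr0.
  rewrite sE PE !addr0 => ck; rewrite scalerA mulVf ?scale1r ?gt_eqF //.
  by apply: cp; rewrite gt_eqF.
have sp : 0 < s by rewrite lt_neqAle eq_sym sn.
have [->|ckn] := eqVneq (c k) 0.
  by rewrite !add0r scale0r add0r.
move=> cs.
have -> : (c k + s)^-1 *: (c k *: p k + P) =
   (c k / (c k + s)) *: p k + (1 - c k / (c k + s)) *: (s^-1 *: P).
  rewrite scalerDr !scalerA mulrC; congr (_ + _ *: _).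
  by field; rewrite sn gt_eqF.
apply: cS; [|by rewrite ler_pdivrMr // mul1r lerDl|exact: cp|exact: IH].
by rewrite divr_ge0 // ltW.
Qed.

Lemma conv_hullP m (p : 'I_m -> E) (A : {set 'I_m}) (x : E) :
  conv_hull (p @` [set` A]) x <->
  exists c : 'I_m -> R, [/\ forall k, 0 <= c k, forall k, k \notin A -> c k = 0,
    \sum_k c k = 1 & x = \sum_k c k *: p k].
Proof.
split; last first.
  case=> c [c0 cA c1 ->] S [cS pS].
  have := @convex_comb_in S _ (index_enum 'I_m) c p cS c0.
  rewrite c1 invr1 scale1r; apply => // k ck; apply: pS; exists k => //=.
  by apply: contraR ck => /cA ->.
pose H := [set x | exists c : 'I_m -> R, [/\ forall k, 0 <= c k, forall k, k \notin A -> c k = 0,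
    \sum_k c k = 1 & x = \sum_k c k *: p k]].
suff : conv_hull (p @` [set` A]) `<=` H by exact.
apply: smallest_sub.
  apply/convex_setP => y z t t0 t1 [c [c0 cA c1 ->]] [d [d0 dA d1 ->]].
  exists (fun k => t * c k + (1 - t) * d k); split.
  - by move=> k; rewrite addr_ge0 // mulr_ge0 // subr_ge0.
  - by move=> k kA; rewrite cA // dA // !mulr0 addr0.
  - by rewrite big_split /= -!mulr_sumr c1 d1 !mulr1 addrC subrK.
  - rewrite !scaler_sumr -big_split /=; apply: eq_bigr => k _.
    by rewrite [RHS]scalerDl !scalerA.
move=> _ [k /= kA <-]; exists (fun j => (j == k)%:R); split.
- by move=> j; rewrite ler0n.
- by move=> j; case: eqP => // ->; rewrite kA.
- by rewrite (bigD1 k) //= eqxx big1 ?addr0 // => j /negbTE ->.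
- rewrite (bigD1 k) //= eqxx scale1r big1 ?addr0 // => j /negbTE ->.
  by rewrite scale0r.
Qed.

Lemma range_setT m (p : 'I_m -> E) : range p = p @` [set` [set: 'I_m]%SET].
Proof.
by apply/seteqP; split => x [k _ <-]; exists k => //=; rewrite inE.
Qed.

Lemma conv_hull_rangeP m (p : 'I_m -> E) (x : E) :
  conv_hull (range p) x <->
  exists c : 'I_m -> R, [/\ forall k, 0 <= c k, \sum_k c k = 1 & x = \sum_k c k *: p k].
Proof.
rewrite range_setT conv_hullP; split => -[c]; first by case=> c0 _ c1 xE; exists c.
by case=> c0 c1 xE; exists c; split=> // k; rewrite inE.
Qed.

Lemma conv_hull_setU (x : E) (S : set E) : conv_hull (x |` conv_hull S) = conv_hull (x |` S).
Proof.
apply/seteqP; split => y yS A [cA SA]; apply: yS; split => //.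
  by move=> z [->|hz]; [apply: SA; left|apply: hz; split => // w Sw; apply: SA; right].
by move=> z [->|hz]; apply: SA; [left|right; move=> B [_]; exact].
Qed.

(** The definition singles out the vertex [ord0]; this form is symmetric. *)
Lemma affine_independentP k (p : 'I_k.+1 -> E) : affine_independent p <->
  (forall c : 'I_k.+1 -> R, \sum_i c i = 0 -> \sum_i c i *: p i = 0 -> forall i, c i = 0).
Proof.
have mulE (u : 'rV_k) : u *m (\matrix_(i < k) (p (lift ord0 i) - p ord0)) =
    \sum_i u ord0 i *: p (lift ord0 i) - (\sum_i u ord0 i) *: p ord0.
  rewrite mulmx_sum_row scaler_suml -sumrB; apply: eq_bigr => i _.
  by rewrite rowK scalerBr.
split=> [fr c c0 cp|H].
  pose u := \row_i c (lift ord0 i).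
  have cz : c ord0 = - \sum_i c (lift ord0 i).
    by move: c0; rewrite big_ord_recl => /eqP; rewrite addr_eq0 => /eqP.
  have u0 : u = 0.
    apply: (row_free_inj fr); rewrite mul0mx mulE -[RHS]cp big_ord_recl cz scaleNr [RHS]addrC.
    congr (_ - _); last by congr (_ *: _); apply: eq_bigr => i _; rewrite mxE.
    by apply: eq_bigr => i _; rewrite mxE.
  have cl i : c (lift ord0 i) = 0 by move/rowP/(_ i): u0; rewrite !mxE.
  move=> i; case: (unliftP ord0 i) => [j|] -> //.
  by rewrite cz big1 ?oppr0.
apply: inj_row_free => u; rewrite mulE => u0.
(* The coefficient of the base vertex is the one that makes the sum vanish. *)
pose c i := if unlift ord0 i is Some j then u ord0 j else - \sum_i u ord0 i.
have cl i : c (lift ord0 i) = u ord0 i by rewrite /c liftK.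
have cz : c ord0 = - \sum_i u ord0 i by rewrite /c unlift_none.
have c0 : forall i, c i = 0.
  apply: (H c).
    by rewrite big_ord_recl cz; under [X in _ + X]eq_bigr do rewrite cl; rewrite addNr.
  by rewrite big_ord_recl cz; under [X in _ + X]eq_bigr do rewrite cl; rewrite scaleNr addrC.
by apply/rowP => i; rewrite mxE -cl c0.
Qed.

Lemma affine_uniq k (p : 'I_k.+1 -> E) (c d : 'I_k.+1 -> R) : affine_independent p ->
  \sum_i c i = \sum_i d i -> \sum_i c i *: p i = \sum_i d i *: p i -> forall i, c i = d i.
Proof.
move=> /affine_independentP H s e i; apply/eqP; rewrite -subr_eq0; apply/eqP.
apply: (H (fun i => c i - d i)); first by rewrite sumrB s subrr.
by under eq_bigr do rewrite scalerBl; rewrite sumrB e subrr.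
Qed.

Lemma affine_inj k (p : 'I_k.+1 -> E) : affine_independent p -> injective p.
Proof.
move=> ap i j pij; apply/eqP; apply: contraT => ij.
have sumd l (F : 'I_k.+1 -> E) : \sum_m ((m == l)%:R : R) *: F m = F l.
  rewrite (bigD1 l) //= eqxx scale1r big1 ?addr0 // => m /negbTE ->.
  by rewrite scale0r.
have sum1 l : \sum_m ((m == l)%:R : R) = 1 :> R.
  by rewrite (bigD1 l) //= eqxx big1 ?addr0 // => m /negbTE ->.
have := @affine_uniq _ p (fun m => (m == i)%:R) (fun m => (m == j)%:R) ap.
rewrite !sumd !sum1 => /(_ erefl pij i)/eqP.
by rewrite eqxx (negbTE ij) oner_eq0.
Qed.

(** A simplex determines its vertices.  Write [p i] as a convex combination of
    the [p' k] and each [p' k] as one of the [p l]; by uniqueness of barycentric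
    coordinates, a [p' k] that occurs with positive coefficient has no component
    on any other vertex than [p i]. *)
Lemma vertex_sub m m' (p : 'I_m.+1 -> E) (p' : 'I_m'.+1 -> E) :
  affine_independent p -> conv_hull (range p) = conv_hull (range p') ->
  forall i, exists k, p' k = p i.
Proof.
move=> ap e i.
have : conv_hull (range p) (p i) by move=> S [_]; apply; exists i.
rewrite e conv_hull_rangeP => -[c [c0 c1 pE]].
have D k : {d : 'I_m.+1 -> R | [/\ forall l, 0 <= d l, \sum_l d l = 1 & p' k = \sum_l d l *: p l]}.
  apply: cid; apply/conv_hull_rangeP; rewrite e => S [_]; apply; exists k => //.
pose d k := projT1 (D k).
have dP k : [/\ forall l, 0 <= d k l, \sum_l d k l = 1 & p' k = \sum_l d k l *: p l].
  exact: projT2 (D k).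
have [k ck] : exists k, 0 < c k.
  have : \sum_k c k != 0 by rewrite c1 oner_eq0.
  rewrite psumr_neq0 // => /hasP[k _ /= ck]; by exists k.
exists k; have [dk0 dk1 ->] := dP k.
have key l : \sum_j c j * d j l = (l == i)%:R.
  apply: (@affine_uniq _ p (fun l => \sum_j c j * d j l) (fun l => (l == i)%:R)) => //.
    rewrite exchange_big /= [RHS](bigD1 i) //= eqxx [X in _ = _ + X]big1 ?addr0 => [|j /negbTE -> //].
    rewrite -[RHS]c1; apply: eq_bigr => j _; rewrite -mulr_sumr.
    by case: (dP j) => _ -> _; rewrite mulr1.
  rewrite [RHS](bigD1 i) //= eqxx scale1r [X in _ = _ + X]big1 ?addr0 => [|j /negbTE ->];
    last by rewrite scale0r.
  rewrite pE; under eq_bigr do rewrite scaler_suml.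
  rewrite exchange_big /=; apply: eq_bigr => j _.
  by case: (dP j) => _ _ ->; rewrite scaler_sumr; apply: eq_bigr => l' _; rewrite scalerA.
have dz l : l != i -> d k l = 0.
  move=> li; have := key l; rewrite (negbTE li) => /eqP.
  rewrite psumr_eq0 => [/allP /(_ k)|j _]; last by rewrite mulr_ge0 //; case: (dP j).
  by rewrite mem_index_enum mulf_eq0 (gt_eqF ck) => /(_ isT)/eqP.
have di : d k i = 1.
  by rewrite -dk1 (bigD1 i) //= big1 ?addr0 // => l /dz.
rewrite (bigD1 i) //= di scale1r big1 ?addr0 // => l /dz ->.
by rewrite scale0r.
Qed.

(** A face is defined through an arbitrary presentation of the simplex; as the
    vertices are unique, one may keep a fixed presentation and name a facet by
    the opposite vertex. *)
Lemma facet_of_simplex (p : 'I_n.+1 -> E) (F : set E) : (0 < n)%N -> affine_independent p ->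
  is_face n.-1 F (conv_hull (range p)) <-> exists i, F = conv_hull (p @` [set` [set~ i]%SET]).
Proof.
move=> n0 ap; split; last first.
  by case=> i ->; exists n, p, [set~ i]%SET; split=> //; rewrite cardsC1 card_ord prednK.
case=> m [p' [A [ap' e cA ->]]].
have s k : {i | p i = p' k} by apply: cid; exact: vertex_sub ap' (esym e) k.
pose sg k := projT1 (s k); have sgE k : p (sg k) = p' k := projT2 (s k).
have sg_inj : injective sg.
  by move=> k l kl; apply: (affine_inj ap'); rewrite -!sgE kl.
pose B : {set 'I_n.+1} := [set sg k | k in A]%SET.
have cB : #|~: B| = 1%N.
  have := cardsC B; rewrite card_ord card_imset // cA prednK //.
  by rewrite -[RHS]addn1 => /addnI.
move/eqP/cards1P: cB => [i Bi]; exists i.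
have -> : [set~ i]%SET = B by rewrite -(finset.setCK B) Bi.
congr conv_hull; apply/seteqP; split => x [k /= kA <-].
  by exists (sg k); rewrite ?sgE //=; exact: imset_f.
by case/imsetP: kA => j jA ->; exists j; rewrite ?sgE.
Qed.

End Convexity.

(** * The Alfeld split in barycentric coordinates *)

Section InteriorPoint.
Context {R : realType} {n : nat}.
Notation E := 'rV[R]_n.

(** If a coordinate of [v] were 0, moving from [v] away from the corresponding
    vertex would leave the simplex at once. *)
Lemma interior_barycentric (p : 'I_n.+1 -> E) (v : E) : affine_independent p ->
  interior (conv_hull (range p)) v ->
  exists lam : 'I_n.+1 -> R, [/\ forall k, 0 < lam k, \sum_k lam k = 1 &
    v = \sum_k lam k *: p k].
Proof.
move=> ap iv; have := nbhs_singleton iv; rewrite conv_hull_rangeP => -[lam [l0 l1 vE]].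
exists lam; split => // i; rewrite lt_neqAle l0 andbT; apply/eqP => li.
have [d d0 hd] := near_plane (v - p i) 0 iv.
have d2 : 0 < d / 2 by rewrite divr_gt0.
have : conv_hull (range p) (v + d / 2 *: (v - p i) + 0 *: 0).
  apply: hd; last by rewrite normr0.
  by rewrite ger0_norm ?ltW // ltr_pdivrMr // ltr_pMr // ltr1n.
rewrite scaler0 addr0 conv_hull_rangeP => -[c [c0 c1 cE]].
have := @affine_uniq _ _ _ p c (fun k => (1 + d / 2) * lam k - d / 2 * (k == i)%:R) ap.
have sd : \sum_k (k == i)%:R = 1 :> R.
  by rewrite (bigD1 i) //= eqxx big1 ?addr0 // => j /negbTE ->.
have pd : \sum_k ((k == i)%:R : R) *: p k = p i.
  rewrite (bigD1 i) //= eqxx scale1r big1 ?addr0 // => j /negbTE ->.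
  by rewrite scale0r.
rewrite sumrB -!mulr_sumr sd l1 c1 !mulr1 addrK => /(_ erefl).
have -> : \sum_k ((1 + d / 2) * lam k - d / 2 * (k == i)%:R) *: p k = \sum_k c k *: p k.
  rewrite -cE; under eq_bigr do rewrite scalerBl -scalerA -[(d / 2 * _) *: _]scalerA.
  by rewrite sumrB -!scaler_sumr -vE pd scalerDl scale1r scalerBr addrA.
move=> /(_ erefl i); rewrite -li mulr0 eqxx sub0r mulr1 => ci.
by have := c0 i; rewrite ci oppr_ge0 leNgt d2.
Qed.

End InteriorPoint.

Section Cell.
Context {R : realType} {n : nat}.
Notation E := 'rV[R]_n.
Variables (p : 'I_n.+1 -> E) (lam : 'I_n.+1 -> R) (v : E).
Hypothesis ap : affine_independent p.
Hypothesis lam0 : forall k, 0 < lam k.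
Hypothesis lam1 : \sum_k lam k = 1.
Hypothesis vE : v = \sum_k lam k *: p k.

Definition split_vertex (i k : 'I_n.+1) : E := if k == i then v else p k.
Definition split_simplex (i : 'I_n.+1) : set E := conv_hull (range (split_vertex i)).
(** Scaled so that the rays add up to 0, which makes the coordinates with
    respect to them unique up to a common shift and the hyperplanes spanned by
    the common facets those of the braid arrangement. *)
Definition ray (k : 'I_n.+1) : E := lam k *: (p k - v).

Lemma lam_neq0 k : lam k != 0.
Proof. by rewrite gt_eqF. Qed.

Lemma sum_ray : \sum_k ray k = 0.
Proof.
rewrite /ray; under eq_bigr do rewrite scalerBr.
by rewrite sumrB -scaler_suml lam1 scale1r -vE subrr.
Qed.

Lemma ray_kernel (a : 'I_n.+1 -> R) : \sum_k a k *: ray k = 0 -> forall k l, a k = a l.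
Proof.
move=> a0; pose S := \sum_k a k * lam k.
suff H k : a k = S by move=> k l; rewrite !H.
have := @affine_uniq _ _ _ p (fun k => a k * lam k) (fun k => S * lam k) ap.
rewrite -mulr_sumr lam1 mulr1 => /(_ erefl).
have -> : \sum_i (a i * lam i) *: p i = \sum_i (S * lam i) *: p i.
  apply/eqP; rewrite -subr_eq0 -[X in _ == X]a0 /ray; apply/eqP.
  under [RHS]eq_bigr do rewrite scalerA scalerBr.
  rewrite [RHS]sumrB; congr (_ - _); rewrite -[RHS]scaler_suml.
  by under eq_bigr do rewrite -scalerA; rewrite -scaler_sumr -vE.
by move=> /(_ erefl k)/(mulIf (lam_neq0 k)).
Qed.

Lemma split_vertex_affine i : affine_independent (split_vertex i).
Proof.
apply/affine_independentP => c c0 cp.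
pose e k := (k != i)%:R * c k + c i * lam k.
have ci : c i = 0.
  have : e i = 0.
    move: ap => /affine_independentP; apply.
      rewrite /e big_split /= -mulr_sumr lam1 mulr1 -[RHS]c0 [RHS](bigD1 i) //= addrC.
      congr (_ + _); rewrite (bigD1 i) //= eqxx mul0r add0r.
      by apply: eq_bigr => k ->; rewrite mul1r.
    rewrite -[RHS]cp /e; under eq_bigr do rewrite scalerDl -[(c i * _) *: _]scalerA.
    rewrite big_split /= -scaler_sumr -vE [RHS](bigD1 i) //= /split_vertex eqxx addrC.
    congr (_ + _); rewrite (bigD1 i) //= eqxx mul0r scale0r add0r.
    by apply: eq_bigr => k /negbTE ->; rewrite mul1r.
  by rewrite /e eqxx mul0r add0r => /eqP; rewrite mulf_eq0 (negbTE (lam_neq0 i)) orbF => /eqP.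
have := (affine_independentP p).1 ap (fun k => c k) c0; apply.
rewrite -[RHS]cp; apply: eq_bigr => k _; rewrite /split_vertex.
by case: eqP => // ->; rewrite ci !scale0r.
Qed.

(** Coordinates on the rays normalized by making the i-th one vanish. *)
Lemma split_simplexP i (x : E) : split_simplex i x <-> exists b : 'I_n.+1 -> R,
  [/\ forall k, 0 <= b k, b i = 0, \sum_k b k * lam k <= 1 & x = v + \sum_k b k *: ray k].
Proof.
rewrite /split_simplex conv_hull_rangeP; split=> -[c].
  case=> c0 c1 xE; exists (fun k => if k == i then 0 else c k / lam k).
  have bE k : k != i -> (if k == i then 0 else c k / lam k) * lam k = c k.
    by move=> /negbTE ->; rewrite divfK ?lam_neq0.
  split.
  - by move=> k; case: ifP => // _; rewrite divr_ge0 // ltW.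
  - by rewrite eqxx.
  - rewrite -c1 (bigD1 i) //= eqxx mul0r add0r [leRHS](bigD1 i) //= ler_wpDl //.
    by apply: ler_sum => k ki; rewrite bE.
  - rewrite xE [in LHS](bigD1 i) //= [in RHS](bigD1 i) //= eqxx scale0r add0r /split_vertex eqxx.
    have -> : c i = 1 - \sum_(k | k != i) c k by rewrite -c1 [in RHS](bigD1 i) //= addrK.
    rewrite scalerBl scale1r scaler_suml -addrA; congr (_ + _).
    rewrite addrC -sumrB; apply: eq_bigr => k ki; rewrite (negbTE ki) /ray scalerA.
    by rewrite divfK ?lam_neq0 // scalerBr.
case=> c0 ci c1 xE; exists (fun k => if k == i then 1 - \sum_k c k * lam k else c k * lam k).
split.
- by move=> k; case: ifP => _; [rewrite subr_ge0|rewrite mulr_ge0 // ltW].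
- rewrite (bigD1 i) //= eqxx [in X in 1 - X](bigD1 i) //= ci mul0r add0r.
  rewrite -[RHS](subrK (\sum_(k | k != i) c k * lam k)); congr (_ + _).
  by apply: eq_bigr => k /negbTE ->.
- rewrite xE (bigD1 i) //= ci scale0r add0r [RHS](bigD1 i) //= eqxx /split_vertex eqxx.
  rewrite scalerBl scale1r -[RHS]addrA; congr (_ + _).
  rewrite scaler_suml [in X in _ = - X + _](bigD1 i) //= ci mul0r scale0r add0r.
  rewrite addrC -sumrB; apply: eq_bigr => k /negbTE ->.
  by rewrite /ray scalerA scalerBr.
Qed.

(** The normalized coordinates are nonnegative with minimum 0 at [i], and any
    others differ from them by a shift. *)
Lemma split_simplex_min i (x : E) (a : 'I_n.+1 -> R) :
  split_simplex i x -> x = v + \sum_k a k *: ray k ->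
  forall k, a i <= a k.
Proof.
rewrite split_simplexP => -[b [b0 bi b1 ->]] /addrI e k.
have : \sum_k (b k - a k) *: ray k = 0.
  by under eq_bigr do rewrite scalerBl; rewrite sumrB e subrr.
move=> /ray_kernel/(_ i k); rewrite bi sub0r => e2.
have aE : a k - a i = b k by rewrite e2 addrC subrK.
by rewrite -subr_ge0 aE.
Qed.

Lemma split_simplex_inj i j : split_simplex i = split_simplex j -> i = j.
Proof.
move=> e; apply/eqP; apply: contraT => ij.
have pij : split_simplex j (p i).
  by move=> S [_]; apply; exists i => //; rewrite /split_vertex (negbTE ij).
rewrite -e in pij.
have := split_simplex_min (a := fun k => (k == i)%:R / lam i) pij.
have -> : \sum_k ((k == i)%:R / lam i) *: ray k = p i - v.
  rewrite (bigD1 i) //= eqxx big1 ?addr0 => [|k /negbTE ->]; last by rewrite mul0r scale0r.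
  by rewrite mul1r /ray scalerA mulVf ?lam_neq0 // scale1r.
rewrite addrC subrK => /(_ erefl j); rewrite eqxx (negbTE (_ : j != i)) 1?eq_sym //.
by rewrite mul0r mul1r invr_le0 leNgt lam0.
Qed.

Lemma alfeldE (T : set E) : (0 < n)%N ->
  alfeld_split (conv_hull (range p)) v T <-> exists i, T = split_simplex i.
Proof.
move=> n0; have cE i : split_simplex i = conv_hull (v |` conv_hull (p @` [set` [set~ i]%SET])).
  rewrite conv_hull_setU; congr conv_hull; apply/seteqP; split => x.
    case=> k _ <-; rewrite /split_vertex; case: eqP => [|/eqP ki]; [by left|right].
    by exists k => //=; rewrite !inE.
  case=> [->|[k /=]]; first by exists i => //; rewrite /split_vertex eqxx.
  by rewrite !inE => /negbTE ki <-; exists k => //; rewrite /split_vertex ki.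
split=> [[F /= /facet_of_simplex]|].
  by move=> /(_ n0 ap)[i ->] <-; exists i; rewrite cE.
case=> i ->; rewrite cE; exists (conv_hull (p @` [set` [set~ i]%SET])) => //=.
by apply/facet_of_simplex => //; exists i.
Qed.

Lemma split_vertex_setC i j : i != j ->
  split_vertex i @` [set` [set~ j]%SET] = split_vertex j @` [set` [set~ i]%SET].
Proof.
suff H k l : k != l ->
    split_vertex k @` [set` [set~ l]%SET] `<=` split_vertex l @` [set` [set~ k]%SET].
  by move=> ij; apply/seteqP; split; apply: H; rewrite // eq_sym.
move=> kl x [m /=]; rewrite !inE => ml <-; rewrite /split_vertex.
have [_|mk] := eqVneq m k.
  by exists l; rewrite /= ?inE 1?eq_sym // eqxx.
by exists m; rewrite /= ?inE // (negbTE ml).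
Qed.

(** By minimality on both sides, the i-th and j-th coordinates of a common point
    coincide; normalized, both vanish. *)
Lemma split_simplex_inter i j : i != j ->
  split_simplex i `&` split_simplex j = conv_hull (split_vertex i @` [set` [set~ j]%SET]).
Proof.
move=> ij; apply/seteqP; split => x.
  case=> ci cj; move: (ci); rewrite /split_simplex conv_hull_rangeP => -[c [c0 c1 xE]].
  apply/conv_hullP; exists c; split=> // k; rewrite !inE negbK => /eqP ->.
  move: (ci); rewrite split_simplexP => -[b [b0 bi b1 xE2]].
  have bj : b j = 0.
    by apply/le_anti; rewrite b0 andbT -bi; exact: (split_simplex_min cj xE2).
  have := @affine_uniq _ _ _ (split_vertex i) c
     (fun k => if k == i then 1 - \sum_k b k * lam k else b k * lam k) (split_vertex_affine i).
  have s1 : \sum_k (if k == i then 1 - \sum_k b k * lam k else b k * lam k) = 1.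
    rewrite (bigD1 i) //= eqxx [in X in 1 - X](bigD1 i) //= bi mul0r add0r.
    rewrite -[RHS](subrK (\sum_(k | k != i) b k * lam k)); congr (_ + _).
    by apply: eq_bigr => m /negbTE ->.
  have s2 : \sum_k (if k == i then 1 - \sum_k b k * lam k else b k * lam k) *: split_vertex i k = x.
    rewrite xE2 (bigD1 i) //= eqxx /split_vertex eqxx [in RHS](bigD1 i) //= bi scale0r add0r.
    rewrite scalerBl scale1r -[LHS]addrA; congr (_ + _).
    rewrite scaler_suml [in X in - X + _](bigD1 i) //= bi mul0r scale0r add0r.
    rewrite addrC -sumrB; apply: eq_bigr => m /negbTE ->.
    by rewrite /ray scalerA scalerBr.
  rewrite s1 s2 c1 -xE => /(_ erefl erefl j).
  by rewrite eq_sym (negbTE ij) bj mul0r.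
have mono k l : conv_hull (split_vertex k @` [set` [set~ l]%SET]) `<=` split_simplex k.
  move=> y; rewrite conv_hullP => -[c [c0 _ c1 yE]].
  by apply/conv_hull_rangeP; exists c.
by move=> hx; split; [exact: mono hx|move: hx; rewrite split_vertex_setC //; exact: mono].
Qed.

Lemma split_simplex_inter_face i j : i != j -> (0 < n)%N ->
  is_face n.-1 (split_simplex i `&` split_simplex j) (split_simplex i) /\
  is_face n.-1 (split_simplex i `&` split_simplex j) (split_simplex j).
Proof.
move=> ij n0; split.
  exists n, (split_vertex i), [set~ j]%SET; split=> //; first exact: split_vertex_affine.
    by rewrite cardsC1 card_ord prednK.
  exact: split_simplex_inter.
exists n, (split_vertex j), [set~ i]%SET; split=> //; first exact: split_vertex_affine.
  by rewrite cardsC1 card_ord prednK.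
by rewrite split_simplex_inter // split_vertex_setC.
Qed.

(** The points of the common facet from which one can still move a little along
    each of the rays that span it, in the positive direction. *)
Definition open_face i j : set E := [set x | exists b : 'I_n.+1 -> R,
  [/\ forall k, 0 <= b k, b i = 0, b j = 0, \sum_k b k * lam k < 1 &
      x = v + \sum_k b k *: ray k]].

Lemma open_face_sub i j : open_face i j `<=` split_simplex i `&` split_simplex j.
Proof.
move=> x [b [b0 bi bj b1 ->]].
by split; apply/split_simplexP; exists b; split=> //; exact: ltW.
Qed.

Lemma open_face_v i j : open_face i j v.
Proof.
exists (fun=> 0); split=> //; first by rewrite big1 // => k _; rewrite mul0r.
by rewrite big1 ?addr0 // => k _; rewrite scale0r.
Qed.

Lemma open_face_ray i j k x : k != i -> k != j -> open_face i j x ->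
  exists2 e : R, 0 < e & forall s, 0 < s < e -> open_face i j (x + s *: ray k).
Proof.
move=> ki kj [b [b0 bi bj b1 ->]]; exists ((1 - \sum_k b k * lam k) / lam k).
  by rewrite divr_gt0 // subr_gt0.
move=> s /andP[s0 s1]; exists (fun l => b l + s * (l == k)%:R); split.
- by move=> l; rewrite addr_ge0 // mulr_ge0 ?ler0n // ltW.
- by rewrite bi eq_sym (negbTE ki) mulr0 addr0.
- by rewrite bj eq_sym (negbTE kj) mulr0 addr0.
- rewrite ltr_pdivlMr // ltrBrDr in s1.
  under eq_bigr do rewrite mulrDl; rewrite big_split /= addrC.
  apply: le_lt_trans s1; rewrite lerD2r (bigD1 k) //= eqxx mulr1 big1 ?addr0 //.
  by move=> l /negbTE ->; rewrite mulr0 mul0r.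
- rewrite -addrA; congr (_ + _); under [RHS]eq_bigr do rewrite scalerDl.
  rewrite big_split /=; congr (_ + _); rewrite (bigD1 k) //= eqxx mulr1 big1 ?addr0 //.
  by move=> l /negbTE ->; rewrite mulr0 scale0r.
Qed.

Definition ray_mx : 'M[R]_n := \matrix_(k < n) ray (lift ord0 k).

Lemma ray_mx_unit : ray_mx \in unitmx.
Proof.
rewrite -row_free_unit; apply: inj_row_free => u u0.
pose a k := if unlift ord0 k is Some l then u ord0 l else 0.
have a0 : \sum_k a k *: ray k = 0.
  rewrite big_ord_recl /a unlift_none scale0r add0r -[RHS]u0 mulmx_sum_row.
  by apply: eq_bigr => k _; rewrite liftK rowK.
apply/rowP => k; have := ray_kernel a0 (lift ord0 k) ord0.
by rewrite /a liftK unlift_none mxE.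
Qed.

(** Coordinates on the rays normalized by [coord ord0 = 0], which makes them
    affine functions of the point. *)
Definition coord (k : 'I_n.+1) (x : E) : R :=
  if unlift ord0 k is Some l then ((x - v) *m invmx ray_mx) ord0 l else 0.

Lemma coordK x : x = v + \sum_k coord k x *: ray k.
Proof.
rewrite big_ord_recl /coord unlift_none scale0r add0r.
have -> : \sum_i (if unlift ord0 (lift ord0 i) is Some l
     then ((x - v) *m invmx ray_mx) ord0 l else 0) *: ray (lift ord0 i) =
   (x - v) *m invmx ray_mx *m ray_mx.
  by rewrite [RHS]mulmx_sum_row; apply: eq_bigr => k _; rewrite liftK rowK.
by rewrite mulmxKV ?ray_mx_unit // addrC subrK.
Qed.

Lemma coord_eq i j x : split_simplex i x -> split_simplex j x -> coord i x = coord j x.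
Proof.
move=> ci cj; apply/le_anti.
by rewrite (split_simplex_min ci (coordK x)) (split_simplex_min cj (coordK x)).
Qed.

Lemma coord_line k (x w : E) (s : R) : coord k (x + s *: w) = coord k x + s * coord k (v + w).
Proof.
rewrite /coord; case: (unlift _ _) => [l|]; last by rewrite mulr0 addr0.
by rewrite [v + w]addrC addrK addrAC mulmxDl -scalemxAl !mxE.
Qed.

End Cell.

(** * Supersmoothness and its sharpness *)

Section dirderSum.
Context {R : realType} {n : nat}.
Notation E := 'rV[R]_n.

Lemma dirder_sum (I : Type) (r : seq I) (c : I -> R) (q : I -> E) f x :
  dirder (\sum_(k <- r) c k *: q k) f x = \sum_(k <- r) c k * dirder (q k) f x.
Proof.
elim: r => [|k r IH].
  by rewrite !big_nil dirderE big1 // => i _; rewrite mxE mul0r.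
rewrite !big_cons -IH; have := dirder_dir (\sum_(j <- r) c j *: q j) (q k) (c k) f x.
by rewrite addrC [RHS]addrC.
Qed.

Lemma jetder_iter_eq0 (w : E) e c al :
  (forall be, (\sum_i be i = \sum_i al i + e)%N -> c be = 0) ->
  iter e (jetder w) c al = 0.
Proof.
elim: e al => [|e IH] al hc; first by apply: hc; rewrite addn0.
rewrite iterS /jetder big1 // => i _; rewrite IH ?mulr0 // => be hbe; apply: hc.
rewrite hbe /shift big_split /= [X in (_ + X + _)%N](bigD1 i) //= eqxx.
by rewrite [X in (_ + (_ + X) + _)%N]big1 ?addn0 ?addn1 ?addSnnS // => j /negbTE ->.
Qed.

Lemma coef_dvdpXn (p : {poly R}) m i : 'X^m %| p -> (i < m)%N -> p`_i = 0.
Proof. by move=> /dvdpP[q ->] im; rewrite coefMXn im. Qed.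

Lemma derivn_at0 (p : {poly R}) e : p^`(e).[0] = p`_e *+ e`!.
Proof. by rewrite horner_coef0 coef_derivn addn0 ffactnn. Qed.

(** The Taylor forms of degree less than [m] vanish in every direction; then
    polarize. *)
Lemma mderiv_eq0_lines (h : E -> R) x m : smooth_on setT h ->
  (forall w, exists2 p : {poly R}, 'X^m %| p & forall s, h (x + s *: w) = p.[s]) ->
  forall al, (\sum_i al i < m)%N -> mderiv al h x = 0.
Proof.
move=> sh hp al lt; apply: (@polarization R n (\sum_i al i)%N (jet h x) setT) => //.
- by exists 0.
- by move=> w b _; exists 1.
move=> w _; rewrite (iter_jetder_jet0 w _ openT sh I).
have [p dp hE] := hp w.
have := @iter_dirder_line _ _ h x w p (\sum_i al i)%N sh hE 0.
by rewrite scale0r addr0 => ->; rewrite derivn_at0 (coef_dvdpXn dp lt) mul0rn.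
Qed.

End dirderSum.

Section AlfeldCell.
Context {R : realType} {n : nat}.
Notation E := 'rV[R]_n.
Variables (p : 'I_n.+1 -> E) (lam : 'I_n.+1 -> R) (v : E).
Hypothesis ap : affine_independent p.
Hypothesis lam0 : forall k, 0 < lam k.
Hypothesis lam1 : \sum_k lam k = 1.
Hypothesis vE : v = \sum_k lam k *: p k.
Hypothesis n0 : (0 < n)%N.
Local Notation ray := (ray p lam v).
Local Notation split_simplex := (split_simplex p v).
Local Notation coord := (coord p lam v).
Local Notation open_face := (open_face p lam v).
Local Notation Delta := (alfeld_split (conv_hull (range p)) v).

Definition ray_comb (a : 'I_n.+1 -> R) : E := \sum_k a k *: ray k.

(** As the rays add up to 0 and [a i = a j], the direction can be rewritten on the
    rays that span the common facet. *)
Lemma tangential_eq0 i j U g (a : 'I_n.+1 -> R) : open U -> smooth_on U g ->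
  split_simplex i `&` split_simplex j `<=` U -> a i = a j ->
  (forall x, open_face i j x -> g x = 0) ->
  forall N x, open_face i j x -> iter N (dirder (ray_comb a)) g x = 0.
Proof.
move=> oU sg cU aij g0; elim=> [|N IH] //= x Zx.
have ray_combE : ray_comb a = \sum_k (a k - a i) *: ray k.
  under [RHS]eq_bigr do rewrite scalerBl.
  by rewrite sumrB -scaler_sumr sum_ray // scaler0 subr0.
rewrite [X in dirder X _]ray_combE dirder_sum big1 // => k _.
have [->|ki] := eqVneq k i; first by rewrite subrr mul0r.
have [->|kj] := eqVneq k j; first by rewrite aij subrr mul0r.
have sI := smooth_iter_dirder (ray_comb a) N oU sg.
have -> : dirder (ray k) (iter N (dirder (ray_comb a)) g) x = 0; last by rewrite mulr0.
apply: (dirder_eq0 (Z := open_face i j) oU sI _ _ IH Zx).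
- by move=> y /(open_face_sub lam0) /cU.
- by move=> y; apply: open_face_ray.
Qed.

(** At the parameter [s] the line crosses the hyperplane spanned by the common
    facet.  Recentred there, its origin is a tangential direction, along which the
    derivatives of [h] of order at most [r] keep vanishing. *)
Lemma dvdp_line_crossing i j U h r d (a b : 'I_n.+1 -> R) (s : R) : open U ->
  smooth_on U h -> split_simplex i `&` split_simplex j `<=` U ->
  (forall al, (\sum_i al i <= r)%N ->
     forall x, (split_simplex i `&` split_simplex j) x -> mderiv al h x = 0) ->
  a i + s * b i = a j + s * b j ->
  ('X - s%:P) ^+ r.+1 %| linepoly d (jet h v) (ray_comb a) (ray_comb b).
Proof.
move=> oU sh cU hd ab.
have ray_combD : ray_comb a + s *: ray_comb b = ray_comb (fun k => a k + s * b k).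
  rewrite /ray_comb scaler_sumr -big_split /=; apply: eq_bigr => k _.
  by rewrite scalerDl scalerA.
have : 'X^(r.+1) %| linepoly d (jet h v) (ray_comb a) (ray_comb b) \Po ('X + s%:P).
  rewrite linepoly_shift ray_combD; apply: dvdp_linepoly => al hal N.
  have Zv := open_face_v p lam v i j.
  rewrite (iter_jetder_jet _ _ _ oU sh); last exact/cU/(open_face_sub lam0 Zv).
  apply: (tangential_eq0 oU (@smooth_mderiv _ _ U h al sh) cU ab _ N Zv).
  by move=> x /(open_face_sub lam0); exact: hd.
move=> /dvdpP[q qE]; apply/dvdpP; exists (q \Po ('X - s%:P)).
have := congr1 (fun q => q \Po ('X - s%:P)) qE.
rewrite /= -comp_polyA comp_polyD comp_polyX comp_polyC subrK comp_polyXr => ->.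
by rewrite comp_polyM rmorphXn /= comp_polyX.
Qed.

(** A neighbourhood of (1, 2, 4, ...), the point being that a sum of two distinct
    powers of 2 determines both. *)
Definition box (a : 'I_n.+1 -> R) := \sum_k `|a k - 2 ^+ k| < 4^-1.

Lemma box_dist a (k : 'I_n.+1) : box a -> 2 ^+ k - 4^-1 < a k /\ a k < 2 ^+ k + 4^-1.
Proof.
move=> ba; have : `|a k - 2 ^+ k| < 4^-1.
  by apply: le_lt_trans ba; rewrite (bigD1 k) //= lerDl sumr_ge0.
by rewrite ltr_norml ltrBrDr ltrBlDr addrC => /andP[-> h]; rewrite addrC.
Qed.

Lemma pow2_gap (i j : nat) : (i < j)%N -> 2 ^+ i + 1 <= 2 ^+ j :> R.
Proof.
move=> ij; rewrite -!natrX natr1 ler_nat -addn1.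
have := leq_pexp2l (isT : (0 < 2)%N) ij; rewrite expnS; have := expn_gt0 2 i; lia.
Qed.

Lemma box_incr a : box a -> forall i j : 'I_n.+1, (i < j)%N -> a i < a j.
Proof.
move=> ba i j /pow2_gap ij; have [_ h1] := box_dist i ba; have [h2 _] := box_dist j ba.
by move: ij h1 h2; lra.
Qed.

Lemma box_sum0 a : box a -> forall i j : 'I_n.+1, (i < j)%N -> a i + a j != 0.
Proof.
move=> ba i j _; have [h1 _] := box_dist i ba; have [h2 _] := box_dist j ba.
have e1 : 1 <= 2 ^+ i :> R by rewrite exprn_ege1 // ler1n.
have e2 : 1 <= 2 ^+ j :> R by rewrite exprn_ege1 // ler1n.
by rewrite gt_eqF //; move: h1 h2 e1 e2; lra.
Qed.

Lemma pow2_sum_lt (i j k l : nat) : (i < j)%N -> (j < l)%N -> (2 ^ i + 2 ^ j < 2 ^ k + 2 ^ l)%N.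
Proof.
move=> ij jl; have h1 := leq_pexp2l (isT : (0 < 2)%N) ij.
have h2 := leq_pexp2l (isT : (0 < 2)%N) jl; have h3 := expn_gt0 2 k.
have h4 := expn_gt0 2 i.
by rewrite !expnS /= in h1 h2 h3 h4; lia.
Qed.

Lemma pow2_sum_inj (i j k l : nat) : (i < j)%N -> (k < l)%N ->
  (2 ^ i + 2 ^ j = 2 ^ k + 2 ^ l)%N -> i = k /\ j = l.
Proof.
move=> ij kl e; have [jl|lj|jl] := ltngtP j l.
- by have := pow2_sum_lt k ij jl; rewrite e ltnn.
- by have := pow2_sum_lt i kl lj; rewrite e ltnn.
- by move: e; rewrite jl => /addIn/eqP; rewrite eqn_exp2l // => /eqP.
Qed.

Lemma box_sum a : box a -> forall P Q : 'I_n.+1 * 'I_n.+1, (P.1 < P.2)%N -> (Q.1 < Q.2)%N ->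
  P != Q -> a P.1 + a P.2 != a Q.1 + a Q.2.
Proof.
move=> ba [i j] [k l] /= ij kl ne.
have [a1 a2] := box_dist i ba; have [b1 b2] := box_dist j ba.
have [c1 c2] := box_dist k ba; have [d1 d2] := box_dist l ba.
have natE (x y : nat) : 2 ^+ x + 2 ^+ y = (2 ^ x + 2 ^ y)%:R :> R.
  by rewrite natrD !natrX.
apply/eqP => e; case: (ltngtP (2 ^ i + 2 ^ j) (2 ^ k + 2 ^ l))%N => [lt|lt|eq].
- have : (2 ^ i + 2 ^ j)%:R + 1 <= (2 ^ k + 2 ^ l)%:R :> R by rewrite natr1 ler_nat.
  by rewrite -!natE; move: a1 a2 b1 b2 c1 c2 d1 d2 e; lra.
- have : (2 ^ k + 2 ^ l)%:R + 1 <= (2 ^ i + 2 ^ j)%:R :> R by rewrite natr1 ler_nat.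
  by rewrite -!natE; move: a1 a2 b1 b2 c1 c2 d1 d2 e; lra.
- case/eqP: ne; have [e1 e2] := pow2_sum_inj ij kl eq.
  by congr pair; apply: val_inj.
Qed.

Lemma box_open : algebraically_open [set ray_comb a | a in [set a | box a]].
Proof.
(* Any direction b is a combination of the rays, by applying the coordinates to v + b. *)
move=> _ b [a /= ba <-]; pose be k := coord k (v + b).
have bE : b = ray_comb be.
  by apply: (addrI v); rewrite {1}(coordK ap lam0 lam1 vE (v + b)).
pose M := \sum_k `|be k|.
have M0 : 0 <= M by rewrite sumr_ge0.
pose ga := 4^-1 - \sum_k `|a k - 2 ^+ k|.
have ga0 : 0 < ga by rewrite subr_gt0.
have M1 : 0 < 1 + M by rewrite ltr_pwDl.
exists (ga / (1 + M)); first exact: divr_gt0.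
move=> s; rewrite ltr_pdivlMr // => sM.
exists (fun k => a k + s * be k) => /=.
  have : \sum_k `|a k + s * be k - 2 ^+ k| <= \sum_k `|a k - 2 ^+ k| + `|s| * M.
    rewrite /M mulr_sumr -big_split /=; apply: ler_sum => k _.
    by rewrite addrAC -normrM ler_normD.
  rewrite /box => /le_lt_trans; apply; rewrite -ltrBrDl.
  by apply: le_lt_trans sM; rewrite ler_wpM2l // lerDr.
rewrite bE /ray_comb scaler_sumr -big_split /=; apply: eq_bigr => k _.
by rewrite scalerDl -scalerA.
Qed.

Lemma split_simplex_mem i : split_simplex i \in Delta.
Proof. by apply/mem_set/(alfeldE v ap _ n0); exists i. Qed.

Definition cell i : Delta := exist _ (split_simplex i) (split_simplex_mem i).

Lemma cell_cases (T : Delta) : exists i, T = cell i.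
Proof.
have /(alfeldE v ap _ n0)[i iE] := set_mem (valP T).
by exists i; apply: val_inj.
Qed.

Lemma split_simplex_v i : split_simplex i v.
Proof. by apply/(split_simplexP _ _ lam0); exists (fun=> 0); split=> //;
  rewrite big1 ?addr0 // => k _; rewrite ?mul0r ?scale0r. Qed.

(** For fixed [d] and [a] in the box, the Taylor forms of the pieces restricted to
    the line [parabola a] satisfy the hypotheses of [crossing_vanish].  Since
    the directions [ray_comb a] fill an open set, polarization concludes. *)
Theorem supersmooth r (s : Defs.family Delta) : splinesS r s -> splinesC v (rho_alfeld n r) s.
Proof.
case=> ss sr; split=> //.
pose f i := fn (s (cell i)); pose U i := dom (s (cell i)).
have oU i : open (U i) by case: (ss (cell i)).
have cU i : split_simplex i `<=` U i by case: (ss (cell i)).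
have sf i : smooth_on (U i) (f i) by case: (ss (cell i)).
have sub_smooth (A B : set E) g : A `<=` B -> smooth_on B g -> smooth_on A g.
  by move=> AB sg t x /AB; exact: sg.
suff main i d : (d <= rho_alfeld n r)%N -> forall al, (\sum_k al k = d)%N ->
    mderiv al (f i) v = mderiv al (f ord0) v.
  move=> T1 T2 al hal; have [i ->] := cell_cases T1; have [j ->] := cell_cases T2.
  by rewrite (main i _ hal al erefl) (main j _ hal al erefl).
move=> dr al hal; apply/eqP; rewrite -subr_eq0; apply/eqP.
apply: (@polarization R n d (jet (f i) v - jet (f ord0) v)
   [set ray_comb a | a in [set a | box a]]) => //; last first.
- move=> _ [a /= ba <-]; rewrite iter_jetderB.
  apply/eqP; rewrite [X in X == _]/(_ - _) subr_eq0; apply/eqP.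
  pose b k := a k ^+ 2.
  pose gam i := linepoly d (jet (f i) v) (ray_comb a) (ray_comb b).
  have ev i' : (gam i').[0] = iter d (jetder (ray_comb a)) (jet (f i') v) idx0.
    by rewrite horner_linepoly scale0r addr0.
  rewrite -!ev; apply: (crossing_vanish (box_incr ba) (box_sum0 ba) (box_sum ba) n0 dr).
    by move=> i'; exact: size_linepoly.
  move=> k l kl; rewrite parabolaB exprZn dvdpZl ?expf_neq0 ?subr_eq0 ?lt_eqF ?(box_incr ba) //.
  rewrite linear_factor ?(box_sum0 ba) // exprZn dvdpZl ?expf_neq0 ?(box_sum0 ba) //.
  have oV : open (U k `&` U l) by apply: openI.
  have sk : smooth_on (U k `&` U l) (f k) by apply: sub_smooth (sf k) => x [].
  have sl : smooth_on (U k `&` U l) (f l) by apply: sub_smooth (sf l) => x [].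
  have Vv : (U k `&` U l) v by split; apply: cU; exact: split_simplex_v.
  rewrite /gam -linepolyB -(jetB oV sk sl Vv).
  have kl' : k != l by rewrite neq_ltn kl.
  apply: (dvdp_line_crossing _ oV (smoothB oV sk sl) (i := k) (j := l)).
  + by move=> x [ck cl]; split; apply: cU.
  + move=> be hbe x cx.
    have Vx : (U k `&` U l) x by case: cx => ck cl; split; apply: cU.
    rewrite [LHS](pderivsB _ oV sk sl Vx); apply/eqP; rewrite subr_eq0; apply/eqP.
    have [F1 F2] := split_simplex_inter_face ap lam0 lam1 vE kl' n0.
    exact: (sr (cell k) (cell l) F1 F2 be hbe x cx).
  + rewrite /b; have := box_sum0 ba kl => nz; field; exact: nz.
- exact: box_open.
- exists (ray_comb (fun k => 2 ^+ k)); exists (fun k => 2 ^+ k) => //=.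
  by rewrite /box big1 ?invr_gt0 // => k _; rewrite subrr normr0.
Qed.

Section Sharp.
Variable r : nat.
Let k := (r.+1 %/ 2)%N.
(** Each pair of weights adds up to at least [r], and for both parities of [r]
    this is achieved with total [rho_alfeld n r]. *)
Definition sharp_weight (l : 'I_n.+1) : nat := if l == ord0 then (r - k)%N else k.
Definition sharp_piece (i : 'I_n.+1) (x : E) : R :=
  (prim (weight_poly sharp_weight 0 (fun l => coord l x))).[coord i x].

Lemma sharp_weight_pair i j : i != j -> (r <= sharp_weight i + sharp_weight j)%N.
Proof.
rewrite /sharp_weight /k; case: (eqVneq i ord0) => [->|_]; case: (eqVneq j ord0) => //; lia.
Qed.

Lemma sharp_weight_sum : (\sum_l sharp_weight l + 0).+1 = (rho_alfeld n r).+1.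
Proof.
rewrite addn0 /sharp_weight (bigD1 ord0) //= /rho_alfeld -/k.
rewrite (eq_bigr (fun=> k)) => [|l /negbTE -> //].
rewrite sum_nat_const cardC1 card_ord /=.
have : (k <= r)%N by rewrite /k; lia.
by case: (n) n0 => // m _ kr; rewrite /= mulSn; lia.
Qed.

Lemma sharp_smooth i : smooth_on setT (sharp_piece i).
Proof.
apply: polyfun_smooth; have pc l : polyfun (coord l).
  rewrite /coord; case: (unlift ord0 l) => [l'|]; [exact: polyfun_linear|exact: polyfun_cst].
exact: polyfun_prim_weight.
Qed.

Definition line_coord (x w : E) (l : 'I_n.+1) : {poly R} :=
  (coord l x)%:P + (coord l (v + w)) *: 'X.

Lemma line_coordE x w l s : (line_coord x w l).[s] = coord l (x + s *: w).
Proof. by rewrite /line_coord coord_line !hornerE mulrC. Qed.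

Definition sharp_line x w i : {poly R} :=
  (prim (weight_poly sharp_weight 0 (line_coord x w))).[line_coord x w i].

Lemma sharp_lineE x w i s : sharp_piece i (x + s *: w) = (sharp_line x w i).[s].
Proof.
rewrite /sharp_line horner_prim_eval map_weight_poly line_coordE /sharp_piece.
congr ((prim (weight_poly _ _ _)).[_]); apply/funext => l.
by rewrite -line_coordE.
Qed.

(** On the line through [x] in a direction [w], the coordinates i and j agree at
    the parameter 0, so the difference of the pieces is divisible by the power
    r + 1 of the parameter. *)
Lemma sharp_contact i j x al : split_simplex i x -> split_simplex j x -> (\sum_k al k <= r)%N ->
  mderiv al (sharp_piece i) x = mderiv al (sharp_piece j) x.
Proof.
move=> ci cj hal; have [->//|ij] := eqVneq i j.
apply/eqP; rewrite -subr_eq0; apply/eqP.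
rewrite -(pderivsB _ openT (sharp_smooth i) (sharp_smooth j) I).
apply: (@mderiv_eq0_lines _ _ _ x r.+1); last by rewrite ltnS.
  exact: smoothB openT (sharp_smooth i) (sharp_smooth j).
move=> w; exists (sharp_line x w i - sharp_line x w j); last first.
  by move=> s; rewrite hornerD hornerN -!sharp_lineE.
apply: dvdp_trans (dvdp_prim_weight _ _ ij (sharp_weight_pair ij)).
rewrite /line_coord (coord_eq ap lam0 lam1 vE ci cj).
have -> : (coord j x)%:P + coord i (v + w) *: 'X - ((coord j x)%:P + coord j (v + w) *: 'X)
   = (coord i (v + w) - coord j (v + w)) *: 'X.
  by rewrite -!mul_polyC polyCB; ring.
by rewrite exprZn -mul_polyC dvdp_mulIr.
Qed.

(** Along the line with coordinates y_l = s l, the difference of two pieces is a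
    polynomial in s of degree at most rho + 1.  If all derivatives up to that
    order agreed at [v] it would be zero, and at s = 1 Rolle's theorem would give
    the weight a root strictly between 0 and 1. *)
Lemma sharp_jets : exists i j, exists2 al, (\sum_k al k <= (rho_alfeld n r).+1)%N &
  mderiv al (sharp_piece i) v <> mderiv al (sharp_piece j) v.
Proof.
pose j : 'I_n.+1 := lift ord0 (Ordinal n0).
exists ord0, j; apply: contrapT => H.
have {}H al : (\sum_k al k <= (rho_alfeld n r).+1)%N ->
    mderiv al (sharp_piece ord0) v = mderiv al (sharp_piece j) v.
  by move=> hal; apply: contrapT => ne; apply: H; exists al.
(* The index l of the row is the coordinate l + 1; coordinate 0 is normalized to 0. *)
pose w : E := (\row_(l < n) l.+1%:R) *m ray_mx p lam v.
have cw l : coord l (v + w) = l%:R.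
  rewrite /coord; case: (unliftP ord0 l) => [l'|] -> //.
  by rewrite [v + w]addrC addrK mulmxK ?ray_mx_unit // mxE.
have cv l : coord l v = 0.
  by rewrite /coord; case: (unlift _ _) => // l'; rewrite subrr mul0mx mxE.
pose h := sharp_piece ord0 - sharp_piece j.
have sh : smooth_on setT h by exact: smoothB openT (sharp_smooth _) (sharp_smooth _).
pose P := sharp_line v w ord0 - sharp_line v w j.
have hP s : h (v + s *: w) = P.[s].
  by rewrite /P hornerD hornerN -!sharp_lineE.
have slc l : (size (line_coord v w l) <= 2)%N.
  rewrite (leq_trans (size_polyD _ _)) // geq_max (leq_trans (size_polyC_leq1 _)) //.
  by rewrite (leq_trans (size_scale_leq _ _)) // size_polyX.
have sz i : (size (sharp_line v w i) <= (rho_alfeld n r).+2)%N.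
  by rewrite -sharp_weight_sum; apply: tdeg_horner (slc i) _; apply/tdeg_prim/tdeg_weight.
have P0 : P = 0.
  apply/polyP => e; rewrite coef0.
  have [le|gt] := leqP e (rho_alfeld n r).+1; last first.
    apply: nth_default; apply: leq_trans gt; rewrite (leq_trans (size_polyD _ _)) //.
    by rewrite size_polyN geq_max !sz.
  have := @iter_dirder_line _ _ h v w P e sh hP 0; rewrite scale0r addr0 derivn_at0.
  rewrite -(iter_jetder_jet0 w e openT sh I) jetder_iter_eq0 => [/esym/eqP|be hbe].
    by rewrite mulrn_eq0 -[_`! == _]negbK -lt0n fact_gt0 => /eqP.
  rewrite /jet [LHS](pderivsB _ openT (sharp_smooth _) (sharp_smooth _) I).
  apply/eqP; rewrite subr_eq0; apply/eqP; apply: H; rewrite hbe.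
  by rewrite (_ : \sum_i idx0 i = 0)%N // big1.
have /eqP : P.[1] = 0 by rewrite P0 horner0.
rewrite /P hornerD hornerN /sharp_line !horner_prim_eval !map_weight_poly subr_eq0.
rewrite !line_coordE !coord_line !cv !cw !add0r !mul1r => /eqP e1.
have ev : (fun l => horner_eval 1 (line_coord v w l)) = (fun l : 'I_n.+1 => (l : nat)%:R).
  apply/funext => l; transitivity (line_coord v w l).[1] => //.
  by rewrite line_coordE coord_line cv cw add0r mul1r.
rewrite ev in e1.
have lt : ((ord0 : 'I_n.+1) : nat)%:R < (j : nat)%:R :> R by rewrite ltr_nat.
have [c /andP[c1 c2]] := rolle_poly lt e1.
rewrite (deriv_prim _ (@unit_nat_real R)) /weight_poly expr0 mulr1 horner_prod => /eqP.
case/prodf_eq0 => l _; rewrite horner_exp expf_eq0 => /andP[_].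
rewrite hornerXsubC subr_eq0 => /eqP cE.
have j1 : (j : nat) = 1%N by [].
by move: c1 c2; rewrite cE !ltr_nat j1; case: (nat_of_ord l) => [|[|l']].
Qed.

Definition sharp_family : Defs.family Delta := fun T =>
  Piece setT (sharp_piece (projT1 (cid (cell_cases T)))).

Lemma sharp_familyE i : fn (sharp_family (cell i)) = sharp_piece i.
Proof.
rewrite /sharp_family /=; case: cid => j /= e; congr sharp_piece.
by apply/esym/(split_simplex_inj ap lam0 lam1 vE); exact: (congr1 val e).
Qed.

Lemma sharp_splinesS : splinesS r sharp_family.
Proof.
split=> [T|T1 T2 F _ _ al hal x].
  by split; [exact: openT| |exact: sharp_smooth].
rewrite /F; have [i ->] := cell_cases T1; have [j ->] := cell_cases T2.
by rewrite !sharp_familyE => -[ci cj]; exact: sharp_contact.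
Qed.

Lemma sharp_not_splinesC m : (rho_alfeld n r < m)%N -> ~ splinesC v m sharp_family.
Proof.
move=> hm [_ hC]; have [i [j [al hal]]] := sharp_jets; apply.
by rewrite -!sharp_familyE; apply: hC; exact: leq_trans hal hm.
Qed.

End Sharp.
End AlfeldCell.

Theorem theorem3 (R : realType) (n r : nat) (T : set 'rV[R]_n) (v : 'rV[R]_n)
    (hn : (2 <= n)%N) (hT : is_simplex n T) (hv : interior T v) :
  is_mos (alfeld_split T v) v r (rho_alfeld n r).
Proof.
case: hT hv => p ap -> hv; have n0 : (0 < n)%N by exact: ltnW.
have [lam [lam0 lam1 vE]] := interior_barycentric ap hv.
split.
  split; first by rewrite /rho_alfeld leq_addr.
  by move=> s; exact: supersmooth.
move=> m [_ hm]; rewrite leNgt; apply/negP => lt.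
apply: (@sharp_not_splinesC _ _ _ _ _ ap lam0 lam1 vE n0 r m lt).
by apply: hm; exact: sharp_splinesS.
Qed.
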